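(* Let $\tilde L$ be a 2-periodic link with quotient link $L$. Then $$V_{\tilde L}(1,q,q^{-1})\equiv\left[V_L(1,q,q^{-1})\right]^2 \mod 2.$$
   Context: Smooth category, oriented links, coefficients $\mathbb{F}_2$. **Periodic links.** An annular link is a link in $A\times I$, $A$ an annulus; its diagram in $A$ is a generic projection to $A$ with crossing information. A 2-periodic link is an oriented link $\tilde L\subset S^3$ with a chosen involution $\tau$ of $S^3$ preserving $\tilde L$ and its orientation, whose fixed set $B$ is an unknot disjoint from $\tilde L$. In coordinates where $B$ is the $z$-axis together with $\infty$ and $\tau$ is rotation by $180^\circ$ about it, with $A$ the $xy$-plane minus the origin $*$, $\tilde L$ is an annular link in $A\times I$. The quotient link $L=\tilde L/\tau$ is an annular link in $(A\times I)/\tau\cong A\times I$. **Annular Khovanov homology.** Let $\mathcal D$ be a diagram in $A$ of an annular link, with $n$ crossings, $n_+$ positive and $n_-$ negative. For $\alpha\in\{0,1\}^n$ let $R_\alpha\subset A$ be the closed 1-manifold obtained by 0- or 1-resolving the crossings according to $\alpha$ (standard Khovanov convention: the 0-resolution of a positive crossing is the oriented one). Let $|\alpha|$ be the number of 1s. A circle of $R_\alpha$ is nontrivial if it has nonzero winding number about $*$, otherwise trivial. $V_\alpha$ is the $\mathbb{F}_2$-vector space with basis the labelings of the circles of $R_\alpha$ by $\pm$ (distinguished generators); labels of nontrivial circles are written $v_\pm$, labels of trivial circles $w_\pm$. $CKh(\mathcal D)=\bigoplus_\alpha V_\alpha$. For a generator $x\in V_\alpha$: $gr_i(x)=|\alpha|-n_-$;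 $gr_j(x)=\#\{+\}-\#\{-\}+|\alpha|+n_+-2n_-$; $gr_k(x)=\#\{\text{nontrivial circles labeled }+\}-\#\{\text{nontrivial circles labeled }-\}$. The differential $\partial_{AKh}$ is the sum of maps $V_\alpha\to V_{\alpha'}$ over all $\alpha'$ obtained from $\alpha$ by changing one 0 to 1, acting as the identity on uninvolved circles and as follows on the circles that split or merge: $v\to vw$: $v_\pm\mapsto v_\pm\otimes w_-$; $vw\to v$: $v_\pm\otimes w_+\mapsto v_\pm$, $v_\pm\otimes w_-\mapsto 0$; $w\to vv$: $w_+\mapsto v_+\otimes v_-+v_-\otimes v_+$, $w_-\mapsto 0$; $vv\to w$: $v_+\otimes v_-,\,v_-\otimes v_+\mapsto w_-$, $v_\pm\otimes v_\pm\mapsto 0$; $w\to ww$: $w_+\mapsto w_+\otimes w_-+w_-\otimes w_+$, $w_-\mapsto w_-\otimes w_-$; $ww\to w$: $w_+\otimes w_+\mapsto w_+$, $w_+\otimes w_-,\,w_-\otimes w_+\mapsto w_-$, $w_-\otimes w_-\mapsto 0$. It raises $gr_i$ by 1 and preserves $gr_j,gr_k$. The homology $AKh$ is an invariant of the annular link; $AKh^{i,j,k}$ is the part in $gr_i=i$, $gr_j=j$, $gr_k=k$. **Polynomials.** For an annular link $L$, $V_L(t,q,x)=\sum_{i,j,k}t^iq^jx^k\operatorname{rk}_{\mathbb{F}_2}AKh^{i,j,k}(L)$. The congruence is between Laurent polynomials in $q$ with integer coefficients. *)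

(* Defs.v *)
From HB Require Import structures.
From mathcomp Require Import all_boot all_order all_algebra.

Set Implicit Arguments.
Unset Strict Implicit.
Unset Printing Implicit Defensive.
Import Order.TTheory GRing.Theory Num.Theory.
Local Open Scope ring_scope.

(** * Oriented annular link diagrams

    An oriented link diagram in the annulus A, generic with respect to the
    angular coordinate, is cut along a ray from the inner to the outer boundary.
    Reading it counterclockwise gives a word of elementary slices, each with one
    cup, cap or crossing, and the diagram is the annular closure of that word.
    Strands are numbered from 0, starting next to the inner boundary; "bottom"
    and "top" of a slice are its sides in the counterclockwise order.

    [Cup i b]   creates strands i and i+1, oriented by b and ~~ b
    [Cap i]     joins strands i and i+1
    [Cross i c] crosses strands i and i+1; the strand from bottom i to top i+1
                is the overstrand iff c

    Orientations are booleans: [true] means counterclockwise. *)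
Inductive slice : Type :=
  | Cup of nat & bool
  | Cap of nat
  | Cross of nat & bool.

Definition is_cross (f : slice) : bool := if f is Cross _ _ then true else false.

(** The orientations above a slice, given those below it; [None] if the slice
    does not fit. *)
Definition act (f : slice) (s : seq bool) : option (seq bool) :=
  match f with
  | Cup i b =>
      if (i <= size s)%N then Some (take i s ++ [:: b; ~~ b] ++ drop i s)
      else None
  | Cap i =>
      if (i.+1 < size s)%N && (nth false s i != nth false s i.+1)
      then Some (take i s ++ drop i.+2 s) else None
  | Cross i _ =>
      if (i.+1 < size s)%N
      then Some (take i s ++ [:: nth false s i.+1; nth false s i] ++ drop i.+2 s)
      else None
  end.

Definition run (s : seq bool) (w : seq slice) : option (seq bool) :=
  foldl (fun o f => obind (act f) o) (Some s) w.

Lemma run_cat s u v : run s (u ++ v) = obind (run^~ v) (run s u).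
Proof.
rewrite /run foldl_cat; case: (foldl _ (Some s) u) => [//|] /=.
by elim: v.
Qed.

Record diagram : Type := Diagram {
  base : seq bool;
  word : seq slice;
  run_word : run base word = Some base }.

(** ** Isotopy of annular links *)

Definition pos (f : slice) : nat :=
  match f with Cup i _ => i | Cap i => i | Cross i _ => i end.

Definition shift (k : nat) (f : slice) : slice :=
  match f with
  | Cup i b => Cup (k + i) b
  | Cap i => Cap (k + i)
  | Cross i c => Cross (k + i) c
  end.

Definition bottom_ends (f : slice) : nat := if f is Cup _ _ then 0 else 2.
Definition top_ends (f : slice) : nat := if f is Cap _ then 0 else 2.

(** The first four rules are the planar isotopies of words of slices (the
    sliding rules move a strand across a local extremum of another one); then
    come the Reidemeister moves.  The other versions of the third Reidemeister
    move follow from [lm_R3] and [lm_R2]. *)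
Inductive local_move : seq slice -> seq slice -> Prop :=
  | lm_exchange f g of (pos f <= pos g)%N :
      local_move [:: f; shift (top_ends f) g] [:: shift (bottom_ends f) g; f]
  | lm_zigzag_l i b : local_move [:: Cup i.+1 b; Cap i] [::]
  | lm_zigzag_r i b : local_move [:: Cup i b; Cap i.+1] [::]
  | lm_slide_cap i c :
      local_move [:: Cross i.+1 c; Cap i] [:: Cross i (~~ c); Cap i.+1]
  | lm_slide_cup i b c :
      local_move [:: Cup i b; Cross i.+1 c] [:: Cup i.+1 b; Cross i (~~ c)]
  | lm_R1_cap i c : local_move [:: Cross i c; Cap i] [:: Cap i]
  | lm_R1_cup i b c : local_move [:: Cup i b; Cross i c] [:: Cup i (~~ b)]
  | lm_R2 i c : local_move [:: Cross i c; Cross i (~~ c)] [::]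
  | lm_R3 i c : local_move [:: Cross i c; Cross i.+1 c; Cross i c]
                           [:: Cross i.+1 c; Cross i c; Cross i.+1 c].

(** [iso_rotate] moves the ray along which the annulus is cut. *)
Inductive isotopic : diagram -> diagram -> Prop :=
  | iso_refl D : isotopic D D
  | iso_sym D D' of isotopic D D' : isotopic D' D
  | iso_trans D D' D'' of isotopic D D' & isotopic D' D'' : isotopic D D''
  | iso_move D D' u v a b of local_move a b
      & base D = base D' & word D = u ++ a ++ v & word D' = u ++ b ++ v :
      isotopic D D'
  | iso_rotate D D' u v of run (base D) u = Some (base D')
      & word D = u ++ v & word D' = v ++ u :
      isotopic D D'.

(** ** Periodic links *)

Fact run_lift D : run (base D) (word D ++ word D) = Some (base D).
Proof. by rewrite run_cat run_word /= run_word. Qed.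

(** The preimage of a diagram under the double covering z |-> z ^ 2 of the
    annulus, with the lifted orientation. *)
Definition lift (D : diagram) : diagram := Diagram (run_lift D).

(** [Lt] and [L] are diagrams of a 2-periodic link and of its quotient: rotating
    by 180 degrees preserves the preimage of a diagram of the quotient, and that
    preimage is a diagram of the periodic link. *)
Definition periodic_with_quotient (Lt L : diagram) : Prop :=
  exists D, isotopic L D /\ isotopic Lt (lift D).

(** * Resolutions *)

Inductive flat : Type :=
  | Vert
  | FlatCup of nat
  | FlatCap of nat
  | CapCup of nat.

Definition resolve (f : slice) (b : bool) : flat :=
  match f with
  | Cup i _ => FlatCup i
  | Cap i => FlatCap i
  | Cross i c => if b == c then CapCup i else Vert
  end.

(** The ends of the strands of a slice are pairs (side, position), the side being
    [true] for the top; [arc f] says that two ends are joined. *)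
Definition turn (i p p' : nat) : bool :=
  ((p == i) && (p' == i.+1)) || ((p == i.+1) && (p' == i)).

Definition skip (i p : nat) : nat := if (p < i)%N then p else p.+2.

Definition arc (f : flat) (e e' : bool * nat) : bool :=
  let: (s, p) := e in let: (s', p') := e' in
  match f with
  | Vert => (s != s') && (p == p')
  | FlatCup i =>
      if s then (if s' then turn i p p' else p == skip i p')
      else s' && (p' == skip i p)
  | FlatCap i =>
      if s then ~~ s' && (p' == skip i p)
      else (if s' then p == skip i p' else turn i p p')
  | CapCup i =>
      if s == s' then turn i p p'
      else [&& p == p', p != i & p != i.+1]
  end.

Section Resolution.
Variable D : diagram.

Let m := size (word D).

Definition slice_at (l : nat) : slice := nth (Cap 0) (word D) l.

Definition signs (l : nat) : seq bool := odflt [::] (run (base D) (take l (word D))).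

(** Points where the diagram meets the rays separating consecutive slices.
    Level [m] and level 0 are two parallel copies of the cutting ray. *)
Definition point : finType := {l : 'I_m.+1 & 'I_(size (signs l))}.

Definition lev (x : point) : nat := tag x.
Definition place (x : point) : nat := tagged x.

Definition crossings : {set 'I_m} := [set l : 'I_m | is_cross (slice_at l)].

(** A vertex of the cube of resolutions is given by the set of the crossings
    that are 1-resolved; only the subsets of [crossings] are relevant. *)
Definition vertex : finType := {set 'I_m}.

(** One step along the resolved diagram.  A dart (x, d) is the passage through
    [x] in the counterclockwise direction iff d. *)
Definition step (al : vertex) (d d' : point * bool) : bool :=
  let: (x, s) := d in let: (y, s') := d' in
  [exists l : 'I_m,
     [&& lev x == (l + ~~ s)%N, lev y == (l + s')%N
       & arc (resolve (slice_at l) (l \in al)) (~~ s, place x) (s', place y)]]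
  || [&& s == s', place x == place y,
         lev x == (if s then m else 0%N) & lev y == (if s then 0%N else m)].

(** The circle through [x], as the set of its points. *)
Definition circle (al : vertex) (x : point) : {set point} :=
  [set y | [exists s, connect (step al) (x, true) (y, s)]].

Definition circles (al : vertex) : {set {set point}} :=
  [set circle al x | x : point].

(** The winding number about the core of the circle through [x], as a signed
    count of intersections with the cutting ray; the circle is oriented so as to
    pass through [x] counterclockwise. *)
Definition winding (al : vertex) (x : point) : int :=
  \sum_(y : point | lev y == 0%N)
     ((connect (step al) (x, true) (y, true))%:R
      - (connect (step al) (x, true) (y, false))%:R).

Definition nontrivial (al : vertex) (C : {set point}) : bool :=
  [exists x in C, winding al x != 0].

(** * Annular Khovanov complex *)

(** A distinguished generator is a vertex of the cube together with a labeling
    of the circles, encoded by the set of the points lying on a circle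
    labeled +. *)
Definition generator : finType := (vertex * {set point})%type.

Definition generators : {set generator} :=
  [set g : generator | (g.1 \subset crossings) &&
     [forall C in circles g.1, (C \subset g.2) || [disjoint C & g.2]]].

Definition plus (g : generator) (C : {set point}) : bool := C \subset g.2.

Definition positive (l : nat) : bool :=
  if slice_at l is Cross i c
  then c == (nth false (signs l) i == nth false (signs l) i.+1) else false.

Definition n_plus : int := #|[set l in crossings | positive l]|%:Z.
Definition n_minus : int := #|[set l in crossings | ~~ positive l]|%:Z.

Definition gr_i (g : generator) : int := #|g.1|%:Z - n_minus.

Definition gr_j (g : generator) : int :=
  #|[set C in circles g.1 | plus g C]|%:Z
  - #|[set C in circles g.1 | ~~ plus g C]|%:Z
  + #|g.1|%:Z + n_plus - 2 * n_minus.

Definition gr_k (g : generator) : int :=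
  #|[set C in circles g.1 | nontrivial g.1 C && plus g C]|%:Z
  - #|[set C in circles g.1 | nontrivial g.1 C && ~~ plus g C]|%:Z.

Definition degree (g : generator) : int * int * int := (gr_i g, gr_j g, gr_k g).

(** Circles are described by pairs (nontrivial, label +): v_+ = (true, true),
    v_- = (true, false), w_+ = (false, true), w_- = (false, false). *)
Definition merge_coef (c1 c2 c : bool * bool) : bool :=
  let: (n1, l1) := c1 in let: (n2, l2) := c2 in let: (n, l) := c in
  match n1, n2, n with
  | true, false, true => l2 && (l == l1)
  | false, true, true => l1 && (l == l2)
  | true, true, false => (l1 != l2) && ~~ l
  | false, false, false => (l1 || l2) && (l == (l1 && l2))
  | _, _, _ => false
  end.

Definition split_coef (c c1 c2 : bool * bool) : bool :=
  let: (n, l) := c in let: (n1, l1) := c1 in let: (n2, l2) := c2 in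
  match n, n1, n2 with
  | true, true, false => (l1 == l) && ~~ l2
  | true, false, true => (l2 == l) && ~~ l1
  | false, true, true => l && (l1 != l2)
  | false, false, false => if l then l1 != l2 else ~~ l1 && ~~ l2
  | _, _, _ => false
  end.

Definition kind (g : generator) (C : {set point}) : bool * bool :=
  (nontrivial g.1 C, plus g C).

(** The circles through one of the four ends of the crossing in slice [l]. *)
Definition involved (al : vertex) (l : nat) : {set {set point}} :=
  [set C in circles al | [exists x in C,
     ((lev x == l) || (lev x == l.+1)) &&
     ((place x == pos (slice_at l)) || (place x == (pos (slice_at l)).+1))]].

(** The coefficient of [h] in the differential of [g]. *)
Definition diff_coef (g h : generator) : bool :=
  [exists l in crossings,
    [&& l \notin g.1, h.1 == l |: g.1,
        [forall C in circles g.1 :\: involved g.1 l, plus g C == plus h C]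
      & [exists C1 : {set point}, exists C2 : {set point}, exists C : {set point},
           [&& C1 != C2, involved g.1 l == [set C1; C2], involved h.1 l == [set C]
             & merge_coef (kind g C1) (kind g C2) (kind h C)]]
        || [exists C : {set point}, exists C1 : {set point}, exists C2 : {set point},
           [&& C1 != C2, involved g.1 l == [set C], involved h.1 l == [set C1; C2]
             & split_coef (kind g C) (kind h C1) (kind h C2)]]]].

Definition gens_of (d : int * int * int) : {set generator} :=
  [set g in generators | degree g == d].

(** The component of the differential from degree [d] to degree [e], acting on
    row vectors. *)
Definition diff (d e : int * int * int) : 'M['F_2]_(#|gens_of d|, #|gens_of e|) :=
  \matrix_(a, b) (diff_coef (enum_val a) (enum_val b))%:R.

(** The rank of AKh in degree (i, j, k): the dimension of the cycles minus that
    of the boundaries, the latter being the row space of the second matrix. *)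
Definition AKh_rank (i j k : int) : int :=
  (\rank (kermx (diff (i, j, k) (i + 1, j, k))))%:Z
  - (\rank (diff (i - 1, j, k) (i, j, k)))%:Z.

(** The sum runs over the degrees in which the complex is nonzero. *)
Definition AKh_poly (F : fieldType) (t q x : F) : F :=
  \sum_(d <- undup [seq degree g | g in generators])
     let: (i, j, k) := d in t ^ i * q ^ j * x ^ k * (AKh_rank i j k)%:~R.

End Resolution.

(** * Laurent polynomials over the integers, in the field of fractions of Z[q] *)

Definition Zq : fieldType := {fraction {poly int}}.

Definition qvar : Zq := tofrac ('X : {poly int}).

Definition is_laurent (f : Zq) : Prop :=
  exists (p : {poly int}) (n : nat), f = tofrac p / qvar ^+ n.

Definition laurent_eqmod2 (f g : Zq) : Prop :=
  exists2 h : Zq, is_laurent h & f - g = 2%:R * h.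

(* Main.v *)
Require Import Defs.
From mathcomp Require Import all_boot all_order all_algebra all_field.
From mathcomp Require Import zify ring.

Set Implicit Arguments.
Unset Strict Implicit.
Unset Printing Implicit Defensive.
Import Order.TTheory GRing.Theory Num.Theory.
Local Open Scope ring_scope.

(** Modulo 2 the graded ranks at t = 1 may be replaced by the graded Euler
    characteristic, hence by a sum over the generators. At x = q^-1 a nontrivial
    circle contributes 1 + 1, so that only the resolutions with all circles
    trivial survive, each with the factor (q + q^-1)^#circles.

    This state sum is isotopy invariant. Suppose that q + q^-1 = N for a large
    integer N, and count the labelings of the points of a resolution by Z/N that
    are constant along arcs and increase by 1 across the cutting ray: there are
    N^#circles of them if all circles are trivial, and none otherwise, since the
    winding numbers are smaller than N. So the state sum is the trace of a
    composite of local operators, for which the local moves and the rotation of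
    the ray are easily checked. Laurent polynomials that agree at these
    infinitely many q are equal.

    A resolution of the double covering is a pair (a, b) of resolutions of the
    quotient; exchanging a and b rotates the covering, so that the pairs with
    a <> b cancel modulo 2. Labelings of the pair (a, a) are labelings of a by
    (Z/N)^2 twisted by (x, y) |-> (y, x + 1); counting them shows that the
    circles of (a, a) are trivial iff those of a are, and twice as many. What
    remains is the sum of the squares, which is the square of the sum. *)

(** * Label operators of flat words *)

(** The obstacle is that the links are known only up to isotopy, while resolutions can be paired for
    [lift D] alone. An isotopy invariant has to carry the congruence across, and circles are global
    objects which a local move rearranges. Labelings make them local: a closed loop is worth the
    number of labels, and the twist leaves no labeling on a circle with nonzero winding number. The
    signs of (-q)^|al| are invisible modulo 2, yet the state sum keeps them. With them invariance is
    an exact identity over every field, so it may be tested at the special values q + q^-1 = N,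
    which are solved in [algC]; a mere congruence could not be tested there. On the homological
    side, the weight q^(j - k) does not involve i. The rank of each differential is therefore
    subtracted twice with the same weight, from its source and from its target, and disappears
    modulo 2. *)

Section Labels.
Variable X : finType.

(** The label words that can stand above [f] if [s] stands below it. *)
Definition nexts (f : flat) (s : seq X) : seq (seq X) :=
  match f with
  | Vert => [:: s]
  | FlatCup i => [seq take i s ++ x :: x :: drop i s | x <- enum X]
  | FlatCap i =>
      if drop i s is x :: y :: r then
        if x == y then [:: take i s ++ r] else [::]
      else [::]
  | CapCup i =>
      if drop i s is x :: y :: r then
        if x == y then [seq take i s ++ z :: z :: r | z <- enum X] else [::]
      else [::]
  end.

(** The transfer matrix of a slice, acting on functions of the word above it; hence the [foldr] in
    [fops]. Values in any [nmodType] cover both counts in [nat] and weighted sums in a field. *)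
Definition fop (R : nmodType) (f : flat) (F : seq X -> R) (s : seq X) : R :=
  \sum_(r <- nexts f s) F r.

Definition fops (R : nmodType) (w : seq flat) (F : seq X -> R) : seq X -> R :=
  foldr (@fop R) F w.

Lemma fops_cat (R : nmodType) u v (F : seq X -> R) :
  fops (u ++ v) F = fops u (fops v F).
Proof. by rewrite /fops foldr_cat. Qed.

End Labels.

Definition fits (f : flat) (n n' : nat) : bool :=
  match f with
  | Vert => n' == n
  | FlatCup i => (i <= n) && (n' == n.+2)
  | FlatCap i => (i <= n') && (n == n'.+2)
  | CapCup i => (i.+1 < n) && (n' == n)
  end%N.

Fixpoint fitsw (w : seq flat) (n n' : nat) : Prop :=
  if w is f :: w' then exists2 k, fits f n k & fitsw w' k n' else n = n'.

Lemma splitat2 (T : Type) i (s : seq T) : (i.+1 < size s)%N ->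
  exists p x y r, s = p ++ x :: y :: r /\ size p = i.
Proof.
move=> h; have := cat_take_drop i s; have := size_drop i s.
case: (drop i s) => [|x [|y r]] /= hs E; [lia|lia|].
by exists (take i s), x, y, r; rewrite E size_takel //; lia.
Qed.

Lemma splitat (T : Type) i (s : seq T) : (i <= size s)%N ->
  exists p r, s = p ++ r /\ size p = i.
Proof.
by move=> h; exists (take i s), (drop i s); rewrite cat_take_drop size_takel.
Qed.

Section LabelOps.
Variable X : finType.
Implicit Types (f : flat) (s p r : seq X) (x y : X).

Lemma nexts_cup i p r : size p = i ->
  nexts (FlatCup i) (p ++ r) = [seq p ++ x :: x :: r | x <- enum X].
Proof. by move=> <-; rewrite /= take_size_cat // drop_size_cat. Qed.

Lemma nexts_cap i p x y r : size p = i ->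
  nexts (FlatCap i) (p ++ x :: y :: r) = if x == y then [:: p ++ r] else [::].
Proof. by move=> <-; rewrite /= take_size_cat // drop_size_cat. Qed.

Lemma nexts_capcup i p x y r : size p = i ->
  nexts (CapCup i) (p ++ x :: y :: r) =
  if x == y then [seq p ++ z :: z :: r | z <- enum X] else [::].
Proof. by move=> <-; rewrite /= take_size_cat // drop_size_cat. Qed.

Variant fits_spec f s (k : nat) : Prop :=
  | FitsVert of f = Vert & k = size s
  | FitsCup i p r of f = FlatCup i & s = p ++ r & size p = i & k = (size s).+2
  | FitsCap i p x y r of f = FlatCap i & s = p ++ x :: y :: r & size p = i
      & k = size (p ++ r)
  | FitsCapCup i p x y r of f = CapCup i & s = p ++ x :: y :: r & size p = i
      & k = size s.

Lemma fitsP f s k : fits f (size s) k -> fits_spec f s k.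
Proof.
case: f => [|i|i|i] /=.
- by move/eqP=> ->; apply: FitsVert.
- case/andP=> /splitat[p [r [-> hp]]] /eqP hk.
  exact: (@FitsCup _ _ _ i p r).
- case/andP=> hi /eqP hk.
  have /splitat2[p [x [y [r [Es hp]]]]]: (i.+1 < size s)%N by lia.
  apply: (@FitsCap _ _ _ i p x y r) => //.
  by move: hk; rewrite Es !size_cat /=; lia.
case/andP=> /splitat2[p [x [y [r [-> hp]]]]] /eqP hk.
exact: (@FitsCapCup _ _ _ i p x y r).
Qed.

Lemma size_nexts f s k r : fits f (size s) k -> r \in nexts f s -> size r = k.
Proof.
case/fitsP=> [-> ->|i p q -> -> hp ->|i p x y q -> -> hp ->|i p x y q -> -> hp ->].
- by rewrite inE => /eqP->.
- by rewrite nexts_cup // => /mapP[x _ ->]; rewrite !size_cat /= !addnS.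
- by rewrite nexts_cap //; case: eqP => // _; rewrite inE => /eqP->.
rewrite nexts_capcup //; case: eqP => // _ /mapP[z _ ->].
by rewrite !size_cat /= !addnS.
Qed.

Lemma uniq_nexts f s k : fits f (size s) k -> uniq (nexts f s).
Proof.
have inj (p q : seq X) : injective (fun z : X => p ++ z :: z :: q).
  by move=> z1 z2 /eqP; rewrite eqseq_cat // => /andP[_ /eqP[]].
case/fitsP=> [-> _|i p q -> -> hp _|i p x y q -> -> hp _|i p x y q -> -> hp _].
- by [].
- by rewrite nexts_cup // map_inj_uniq ?enum_uniq.
- by rewrite nexts_cap //; case: eqP.
by rewrite nexts_capcup //; case: eqP => // _; rewrite map_inj_uniq ?enum_uniq.
Qed.

Variable R : nmodType.
Implicit Types F G : seq X -> R.

Lemma fop_vert F s : fop Vert F s = F s.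
Proof. by rewrite /fop big_seq1. Qed.

Lemma fop_cup i F p r : size p = i ->
  fop (FlatCup i) F (p ++ r) = \sum_(x : X) F (p ++ x :: x :: r).
Proof. by move=> h; rewrite /fop nexts_cup // big_map big_enum. Qed.

Lemma fop_cap i F p x y r : size p = i ->
  fop (FlatCap i) F (p ++ x :: y :: r) = if x == y then F (p ++ r) else 0.
Proof.
by move=> h; rewrite /fop nexts_cap //; case: eqP; rewrite ?big_seq1 ?big_nil.
Qed.

Lemma fop_capcup i F p x y r : size p = i ->
  fop (CapCup i) F (p ++ x :: y :: r) =
  if x == y then \sum_(z : X) F (p ++ z :: z :: r) else 0.
Proof.
move=> h; rewrite /fop nexts_capcup //; case: eqP; last by rewrite big_nil.
by rewrite big_map big_enum.
Qed.

Lemma eq_fop f k F G s : fits f (size s) k ->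
  (forall r, size r = k -> F r = G r) -> fop f F s = fop f G s.
Proof.
move=> hf eFG; rewrite /fop !big_seq; apply: eq_bigr => r hr.
exact/eFG/(size_nexts hf).
Qed.

Lemma eq_fops w k F G s : fitsw w (size s) k ->
  (forall r, size r = k -> F r = G r) -> fops w F s = fops w G s.
Proof.
elim: w s => [|f w IHw] s /=; first by move=> <-; apply.
case=> j hf hw eFG; apply: (eq_fop hf) => r hr.
by apply: IHw => //; rewrite hr.
Qed.

Lemma fops_ext w F G s : F =1 G -> fops w F s = fops w G s.
Proof.
move=> eFG; elim: w s => [|f w IHw] s //=.
by rewrite /fop; apply: eq_bigr => r _; apply: IHw.
Qed.

Lemma fop_sum f (I : Type) (js : seq I) (H : I -> seq X -> R) s :
  fop f (fun r => \sum_(j <- js) H j r) s = \sum_(j <- js) fop f (H j) s.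
Proof. exact: exchange_big. Qed.

Lemma fops_sum w (I : Type) (js : seq I) (H : I -> seq X -> R) s :
  fops w (fun r => \sum_(j <- js) H j r) s = \sum_(j <- js) fops w (H j) s.
Proof.
elim: w s => [|f w IHw] s //=; rewrite -fop_sum /fop.
by apply: eq_bigr => r _; apply: IHw.
Qed.

End LabelOps.

Lemma fop_additive (X : finType) (R S : nmodType) (h : R -> S) f
    (F : seq X -> R) s : h 0 = 0 -> {morph h : a b / a + b} ->
  fop f (h \o F) s = h (fop f F s).
Proof.
move=> h0 hD; rewrite /fop; elim: (nexts f s) => [|r l IH].
  by rewrite !big_nil h0.
by rewrite !big_cons IH hD.
Qed.

Lemma fops_additive (X : finType) (R S : nmodType) (h : R -> S) w
    (F : seq X -> R) s : h 0 = 0 -> {morph h : a b / a + b} ->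
  fops w (h \o F) s = h (fops w F s).
Proof.
move=> h0 hD; elim: w s => [|f w IHw] s //=; rewrite -(fop_additive f _ s h0 hD).
by rewrite /fop; apply: eq_bigr => r _; apply: IHw.
Qed.

(** The number of labelings of the closure of [w] by [X], twisted by [g] along
    the cutting ray. *)
Definition fcount (X : finType) (g : X -> X) (n : nat) (w : seq flat) : nat :=
  (\sum_(s : n.-tuple X) fops w (fun r => (r == map g s)%:R) s)%R.

(** * Cyclicity of the twisted trace *)

Section Rotation.
Variables (X : finType) (g : X -> X) (g_inj : injective g).

(** Slices only compare labels or let a label run over all of [X], so a permutation of [X] commutes
    with transitions. It reorders [enum X], hence [perm_eq]. *)
Lemma map_nexts f (s : seq X) : bijective g ->
  perm_eq (nexts f (map g s)) [seq map g r | r <- nexts f s].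
Proof.
move=> g_bij.
have enumg (h : X -> seq X) :
    perm_eq [seq h x | x <- enum X] [seq h (g x) | x <- enum X].
  rewrite [X in perm_eq _ X](_ : _ = [seq h y | y <- [seq g x | x <- enum X]]).
    apply: perm_map; apply: uniq_perm; first exact: enum_uniq.
      by rewrite map_inj_uniq ?enum_uniq.
    move=> x; rewrite mem_enum inE; have [g' gK g'K] := g_bij.
    by apply/esym/mapP; exists (g' x); rewrite ?mem_enum ?g'K.
  by rewrite -map_comp.
case: f => [|i|i|i] //=; rewrite -map_take -map_drop.
- rewrite -map_comp; apply: perm_trans (enumg _) _.
  rewrite (_ : map _ _ = [seq ([eta map g] \o
    (fun x => take i s ++ x :: x :: drop i s)) x | x <- enum X]) //.
  by apply: eq_map => x /=; rewrite map_cat.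
- case: (drop i s) => [|x [|y r]] //=; rewrite (inj_eq g_inj).
  by case: eqP => //= _; rewrite map_cat.
case: (drop i s) => [|x [|y r]] //=; rewrite (inj_eq g_inj).
case: eqP => //= _; rewrite -map_comp; apply: perm_trans (enumg _) _.
rewrite (_ : map _ _ = [seq ([eta map g] \o
  (fun z => take i s ++ z :: z :: r)) x | x <- enum X]) //.
by apply: eq_map => z /=; rewrite map_cat.
Qed.

Lemma fops_map (R : nmodType) w (F : seq X -> R) s :
  fops w F (map g s) = fops w (F \o map g) s.
Proof.
have g_bij := injF_bij g_inj; elim: w s => [|f w IHw] s //=.
rewrite /fop (perm_big _ (map_nexts f s g_bij)) big_map.
by apply: eq_bigr => r _; apply: IHw.
Qed.

Lemma fops_delta (R : pzSemiRingType) w k (F : seq X -> R) s :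
    fitsw w (size s) k ->
  fops w F s = \sum_(r : k.-tuple X) fops w (fun t => (t == r)%:R) s * F r.
Proof.
move=> hw; have mulF c r : fops w (fun t => (t == r :> seq X)%:R) s * c
    = fops w (fun t => (t == r)%:R * c) s.
  rewrite -(fops_additive (h := fun a => a * c)) ?mul0r //.
  by move=> a b; rewrite mulrDl.
under eq_bigr do rewrite mulF.
rewrite -fops_sum; apply: (eq_fops hw) => r hr.
have hr' : size r == k by apply/eqP.
rewrite (bigD1 (Tuple hr')) //= eqxx mul1r big1 ?addr0 // => t nt.
by rewrite (_ : r == t = false) ?mul0r //; apply/eqP => E; case/eqP: nt; apply/val_inj.
Qed.

Let mat w (s r : seq X) : nat := fops w (fun t => (t == r)%:R) s.

Lemma fcount_cat n k u v : fitsw u n k -> fitsw v k n ->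
  fcount g n (u ++ v) =
  \sum_(s : n.-tuple X) \sum_(r : k.-tuple X) mat u s r * mat v r (map g s).
Proof.
move=> hu hv; rewrite /fcount; apply: eq_bigr => s _; rewrite fops_cat.
by rewrite (fops_delta (k := k)) ?size_tuple.
Qed.

(** The factor carried across the ray acquires [map g] on both of its arguments, and [fops_map]
    removes it again. *)
Lemma fcount_rot n k u v : fitsw u n k -> fitsw v k n ->
  fcount g n (u ++ v) = fcount g k (v ++ u).
Proof.
move=> hu hv; rewrite (fcount_cat hu hv) (fcount_cat hv hu).
rewrite exchange_big; apply: eq_bigr => r _.
have g_bij : bijective (map_tuple g : n.-tuple X -> n.-tuple X).
  by apply: injF_bij => s t /(congr1 val) /= /(inj_map g_inj) /val_inj.
rewrite [RHS](reindex _ (onW_bij _ g_bij)) /=.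
apply: eq_bigr => s _; rewrite mulrC; congr (_ * _).
rewrite [RHS]/mat fops_map; apply: (eq_fops (k := k)); rewrite ?size_tuple //.
by move=> t _ /=; rewrite (inj_eq (inj_map g_inj)).
Qed.

End Rotation.

(** * Pairs of labelings and the doubled word *)

Section PairLabels.
Variable X : finType.
Implicit Types s t : seq X.

Lemma fop_zip (R : nmodType) f k (F : seq (X * X) -> R) s t :
    size s = size t -> fits f (size s) k ->
  fop f F (zip s t) = fop f (fun s' => fop f (fun t' => F (zip s' t')) t) s.
Proof.
have zz (p p' : seq X) i : size p = i -> size p' = i -> size (zip p p') = i.
  by rewrite size_zip => -> ->; rewrite minnn.
move=> hst; case/fitsP=> [-> _|i p r -> Es hp _|i p x y r -> Es hp _|i p x y r -> Es hp _].
- by rewrite !fop_vert.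
- have /splitat[p' [r' [Et hp']]] : (i <= size t)%N.
    by rewrite -hst Es size_cat; lia.
  have hz := zz _ _ _ hp hp'.
  rewrite Es Et zip_cat ?hp ?hp' // fop_cup //.
  rewrite fop_cup //; transitivity (\sum_a \sum_b
    F (zip (p ++ a :: a :: r) (p' ++ b :: b :: r'))); last first.
    by apply: eq_bigr => a _; rewrite fop_cup.
  rewrite pair_big; apply: eq_bigr => -[a b] _ /=.
  by rewrite !zip_cat ?hp ?hp'.
- have /splitat2[p' [x' [y' [r' [Et hp']]]]] : (i.+1 < size t)%N.
    by rewrite -hst Es size_cat /=; lia.
  have hz := zz _ _ _ hp hp'.
  rewrite Es Et zip_cat ?hp ?hp' //= fop_cap //.
  rewrite !fop_cap // xpair_eqE; case: eqP => //= _; case: eqP => //= _.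
  by rewrite zip_cat ?hp ?hp'.
have /splitat2[p' [x' [y' [r' [Et hp']]]]] : (i.+1 < size t)%N.
  by rewrite -hst Es size_cat /=; lia.
have hz := zz _ _ _ hp hp'.
rewrite Es Et zip_cat ?hp ?hp' //= fop_capcup //.
rewrite fop_capcup // xpair_eqE; case: eqP => //= _.
transitivity (\sum_a if x' == y' then
    \sum_b F (zip (p ++ a :: a :: r) (p' ++ b :: b :: r')) else 0); last first.
  by apply: eq_bigr => a _; rewrite fop_capcup.
case: eqP => _ //=; last by rewrite big1.
rewrite pair_big /=; apply: eq_bigr => -[a b] _ /=.
by rewrite !zip_cat ?hp ?hp'.
Qed.

Lemma fops_zip (R : nmodType) w k (F : seq (X * X) -> R) s t :
    size s = size t -> fitsw w (size s) k ->
  fops w F (zip s t) = fops w (fun s' => fops w (fun t' => F (zip s' t')) t) s.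
Proof.
elim: w s t => [|f w IHw] s t //= hst [j hf hw].
rewrite (fop_zip _ hst hf) -/(fops w).
apply: (eq_fop hf) => s' hs'.
transitivity (fop f (fun t' =>
  fops w (fun s'' => fops w (fun t'' => F (zip s'' t'')) t') s') t).
  apply: (eq_fop (k := j)); rewrite -?hst // => t' ht'.
  by rewrite IHw ?hs' ?ht'.
by rewrite /fop -fops_sum.
Qed.

(** Cut a labeling of [w ++ w] at its middle: the two halves are the components of a pair labeling
    of [w]. The first half ends where the second begins, and the second ends at [h] of the start of
    the first, which is the twist by (a, b) |-> (b, h a). *)
Lemma fcount_pair (h : X -> X) n w : fitsw w n n ->
  fcount (fun a : X * X => (a.2, h a.1)) n w = fcount h n (w ++ w).
Proof.
move=> hw; rewrite (fcount_cat _ hw hw) pair_big /fcount.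
pose z (a : n.-tuple X * n.-tuple X) : n.-tuple (X * X) := zip_tuple a.1 a.2.
have z_bij : bijective z.
  exists (fun u : n.-tuple (X * X) =>
    (map_tuple fst u : n.-tuple X, map_tuple snd u : n.-tuple X)) => [[a b]|u].
    by congr pair; apply: val_inj; 
      rewrite /= -/unzip1 -/unzip2 ?unzip1_zip ?unzip2_zip ?size_tuple.
  by apply: val_inj; rewrite /= zip_unzip.
rewrite (reindex _ (onW_bij _ z_bij)) /=; apply: eq_bigr => -[s t] _ /=.
rewrite (fops_zip (k := n)) ?size_tuple //.
rewrite -(fops_additive (h := fun c => c * _)) ?mul0r //; last first.
  by move=> a b; rewrite mulrDl.
apply: (eq_fops (k := n)); rewrite ?size_tuple // => s' hs' /=.
rewrite -(fops_additive (h := fun c => _ * c)) ?mulr0 //; last first.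
  by move=> a b; rewrite mulrDr.
have -> : [seq (a.2, h a.1) | a <- zip s t] = zip t (map h s).
  have: size s = size t by rewrite !size_tuple.
  by elim: (val s) (val t) => [|a s1 IH] [|b t1] //= [/IH->].
apply: (eq_fops (k := n)); rewrite ?size_tuple // => t' ht' /=.
rewrite -natrM mulnb; congr (_%:R); congr nat_of_bool.
apply/eqP/andP => [E|[/eqP-> /eqP->] //].
have := congr1 unzip1 E; have := congr1 unzip2 E.
have e1 : size s' = size t' by rewrite hs' ht'.
have e2 : size t = size (map h s) by rewrite size_map !size_tuple.
rewrite !unzip1_zip ?e1 ?e2 // !unzip2_zip ?e1 ?e2 //.
by move=> -> ->; rewrite !eqxx.
Qed.

End PairLabels.

(** * Arcs of a slice *)

(** Writing [arc] as the graph of a function makes the walk along a resolution deterministic. *)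
Definition mate (f : flat) (e : bool * nat) : bool * nat :=
  let: (s, p) := e in
  match f with
  | Vert => (~~ s, p)
  | FlatCup i =>
      if s then
        if p == i then (true, i.+1) else if p == i.+1 then (true, i)
        else (false, if (p < i)%N then p else p.-2)
      else (true, skip i p)
  | FlatCap i =>
      if s then (false, skip i p)
      else if p == i then (false, i.+1) else if p == i.+1 then (false, i)
      else (true, if (p < i)%N then p else p.-2)
  | CapCup i =>
      if p == i then (s, i.+1) else if p == i.+1 then (s, i) else (~~ s, p)
  end.

Lemma arcE f e e' : Defs.arc f e e' = (e' == mate f e).
Proof.
case: e e' => [s p] [s' p']; case: f => [|i|i|i] /=; rewrite /turn /skip.
- by case: s s' => [] [] //=; rewrite xpair_eqE //= eq_sym.
- case: s s' => [] [] //=; (repeat case: ifP => //=); rewrite xpair_eqE /=; lia.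
- case: s s' => [] [] //=; (repeat case: ifP => //=); rewrite xpair_eqE /=; lia.
by case: s s' => [] [] /=; (repeat case: ifP => //=); rewrite xpair_eqE /=; lia.
Qed.

Definition in_range (n n' : nat) (e : bool * nat) : bool :=
  (e.2 < if e.1 then n' else n)%N.

Lemma mate_neq f e : mate f e != e.
Proof.
case: e => s p.
case: f => [|i|i|i] /=; rewrite /skip; case: s => //=;
  repeat (case: ifP => //= ?); rewrite ?xpair_eqE /=; lia.
Qed.

Section Mate.
Variables (f : flat) (n n' : nat).
Hypothesis hf : fits f n n'.

Lemma mate_range e : in_range n n' e -> in_range n n' (mate f e).
Proof.
move: hf; case: e => s p; rewrite /in_range.
case: f => [|i|i|i] /=; rewrite /skip; case: s => /=;
  (repeat case: ifP => //=); lia.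
Qed.

Lemma mateK e : in_range n n' e -> mate f (mate f e) = e.
Proof.
move: hf; case: e => s p; rewrite /in_range.
case: f => [|i|i|i]; first by case: s.
all: rewrite /= /skip; case: s => /= hf' hp;
  case: (ltnP p i) => ?; case: (p =P i) => ?; case: (p =P i.+1) => ? //=;
  rewrite /skip /=; repeat (case: ifP => /= ?); first [done | exfalso; lia | congr pair; lia].
Qed.

End Mate.

Definition elabel (X : Type) (x0 : X) (s r : seq X) (e : bool * nat) : X :=
  nth x0 (if e.1 then r else s) e.2.

(** * Transitions as labelings constant along arcs *)

Section MemNexts.
Variables (X : finType) (x0 : X).
Implicit Types (p s r : seq X) (x y : X).

Lemma nth_insert2 i p x y r q : size p = i ->
  nth x0 (p ++ x :: y :: r) q =
  if q == i then x else if q == i.+1 then y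
  else nth x0 (p ++ r) (if (q < i)%N then q else q.-2).
Proof.
move=> <-; rewrite nth_cat; case: ltngtP => // [hq|hq|->].
- have -> : (q == (size p).+1) = false by lia.
  by rewrite nth_cat hq.
- case: eqP => [->|/eqP hq']; first by rewrite subSn // subnn.
  rewrite nth_cat (_ : (q.-2 < size p)%N = false); last by lia.
  by rewrite (_ : q - size p = (q.-2 - size p).+2)%N //; lia.
by rewrite subnn.
Qed.

Lemma nth_skip i p x y r q : size p = i ->
  nth x0 (p ++ x :: y :: r) (skip i q) = nth x0 (p ++ r) q.
Proof.
move=> hp; rewrite (nth_insert2 _ _ _ _ hp) /skip.
case: ltnP => h; first by rewrite h !ifF //; lia.
by rewrite !ifF //; lia.
Qed.

Lemma mem_nexts_mate f s r e :
    fits f (size s) (size r) -> r \in nexts f s ->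
  elabel x0 s r e = elabel x0 s r (mate f e).
Proof.
move=> hf; case: e => b q.
case/fitsP: hf => [-> _|i p r0 -> -> hp _|i p x y r0 -> -> hp _|i p x y r0 -> -> hp _].
- by rewrite inE => /eqP->; case: b.
- rewrite nexts_cup // => /mapP[x _ ->]; case: b => /=; rewrite /elabel /=.
    have := nth_insert2 x x r0 q hp.
    case: (q == i) => -> /=; first by rewrite (nth_insert2 _ _ _ _ hp) eqxx ifF //; lia.
    by case: (q == i.+1) => /=; first by rewrite (nth_insert2 _ _ _ _ hp) eqxx.
  by rewrite (nth_skip _ _ _ _ hp).
- rewrite nexts_cap //; case: (x =P y) => // <-; rewrite inE => /eqP->.
  case: b => /=; rewrite /elabel /=; first by rewrite (nth_skip _ _ _ _ hp).
  have := nth_insert2 x x r0 q hp.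
  case: (q == i) => -> /=; first by rewrite (nth_insert2 _ _ _ _ hp) eqxx ifF //; lia.
  by case: (q == i.+1) => /=; first by rewrite (nth_insert2 _ _ _ _ hp) eqxx.
rewrite nexts_capcup //; case: (x =P y) => // <- /mapP[z _ ->].
have hi : (i.+1 == i) = false by lia.
by case: b => /=; rewrite /elabel /=; (case: (q =P i) => [->|/eqP/negbTE h1] /=;
  last case: (q =P i.+1) => [->|/eqP/negbTE h2] /=);
  rewrite !(nth_insert2 _ _ _ _ hp) ?eqxx ?h1 ?h2 ?hi.
Qed.

Lemma mem_nexts f s r :
    fits f (size s) (size r) ->
    (forall e, in_range (size s) (size r) e ->
               elabel x0 s r e = elabel x0 s r (mate f e)) ->
  r \in nexts f s.
Proof.
move=> hf hl.
(* It suffices to find one transition [r'] that agrees with [r] at the top ends joined to top ends: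
   all other top labels are copied from [s], for [r] and [r'] alike. *)
have detect r' : r' \in nexts f s ->
    (forall q, (q < size r)%N -> (mate f (true, q)).1 -> nth x0 r' q = nth x0 r q) ->
    r \in nexts f s.
  move=> hr' hq; suff -> : r = r' by [].
  have hs : size r' = size r by exact: size_nexts hf hr'.
  apply: (eq_from_nth (x0 := x0)) => // q hqr.
  case E: (mate f (true, q)).1; first by rewrite hq.
  have := hl (true, q); rewrite /in_range /= => /(_ hqr).
  have := @mem_nexts_mate f s r' (true, q); rewrite hs => /(_ hf hr').
  by rewrite /elabel E /= => -> ->.
have hl' q : (q < size s)%N -> nth x0 s q = elabel x0 s r (mate f (false, q)).
  by move=> hq; rewrite -hl.
have hr' q : (q < size r)%N -> nth x0 r q = elabel x0 s r (mate f (true, q)).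
  by move=> hq; rewrite -hl.
move: (hf); case/fitsP=> [Ef Er|i p r0 Ef Es hp Er
  |i p x y r0 Ef Es hp Er|i p x y r0 Ef Es hp Er];
  move: detect hl' hr'; rewrite Ef => detect hl' hr'.
- by apply: (detect s); rewrite ?inE.
(* The free label of the cup is read off [r]. *)
- apply: (detect (p ++ nth x0 r i :: nth x0 r i :: r0)).
    by rewrite Es nexts_cup //; apply/mapP; exists (nth x0 r i); rewrite ?mem_enum.
  move=> q hq /=; rewrite (nth_insert2 _ _ _ _ hp).
  case: eqP => [->|h1] //=; case: eqP => [Eq|//] /= _.
  by rewrite [RHS]hr' //= Eq eqxx ifF //; lia.
- have Exy : x = y.
    have hi : (i.+1 == i) = false by lia.
  have := hl' i; rewrite Es /= eqxx /elabel /= !(nth_insert2 _ _ _ _ hp).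
    by rewrite !eqxx hi => -> //; rewrite size_cat /=; lia.
  apply: (detect (p ++ r0)) => [|q hq //].
  by rewrite Es nexts_cap // Exy eqxx inE.
have Exy : x = y.
  have hi : (i.+1 == i) = false by lia.
  have := hl' i; rewrite Es /= eqxx /elabel /= !(nth_insert2 _ _ _ _ hp).
  by rewrite !eqxx hi => -> //; rewrite size_cat /=; lia.
apply: (detect (p ++ nth x0 r i :: nth x0 r i :: r0)).
  rewrite Es nexts_capcup // Exy eqxx.
  by apply/mapP; exists (nth x0 r i); rewrite ?mem_enum.
move=> q hq /=; rewrite (nth_insert2 _ _ _ _ hp).
case: eqP => [->|h1] //=; case: eqP => [Eq|//] /= _.
by rewrite [RHS]hr' //= Eq eqxx ifF //; lia.
Qed.

End MemNexts.

(** * Darts of a resolution *)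

Lemma act_fits f s s' b : act f s = Some s' ->
  fits (resolve f b) (size s) (size s').
Proof.
case: f => [i o|i|i c] /=.
- by case: ifP => // hi [<-]; rewrite size_cat /= size_drop size_takel //; lia.
- case: ifP => // /andP[hi _] [<-].
  by rewrite size_cat /= size_drop size_takel //; lia.
case: ifP => // hi [<-]; rewrite size_cat /= size_drop size_takel; last by lia.
by case: eqP => _ /=; lia.
Qed.

Section Geometry.
Variable D : diagram.
Notation m := (size (word D)).

Lemma run_take l : (l <= m)%N -> run (base D) (take l (word D)) = Some (signs D l).
Proof.
move=> _; rewrite /signs; have := run_word D.
rewrite -{1}(cat_take_drop l (word D)) run_cat.
by case: (run (base D) (take l (word D))).
Qed.

Lemma signs0 : signs D 0 = base D.
Proof. by rewrite /signs take0. Qed.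

Lemma signs_last : signs D m = base D.
Proof. by rewrite /signs take_size run_word. Qed.

Lemma act_signs l : (l < m)%N -> act (slice_at D l) (signs D l) = Some (signs D l.+1).
Proof.
move=> hl; have := run_take hl; rewrite (take_nth (Cap 0)) // -cats1 run_cat.
by rewrite run_take 1?ltnW.
Qed.

Definition width (l : nat) : nat := size (signs D l).

Lemma width_last : width m = width 0.
Proof. by rewrite /width signs0 signs_last. Qed.

Lemma point_eq (x y : point D) : lev x = lev y -> place x = place y -> x = y.
Proof.
case: x y => [l p] [l' p']; rewrite /lev /place /= => /val_inj E; subst l'.
by move=> /val_inj ->.
Qed.

Lemma exists_point l p : (l <= m)%N -> (p < width l)%N ->
  exists x : point D, lev x = l /\ place x = p.
Proof.
move=> hl hp; pose i : 'I_m.+1 := Ordinal (hl : (l < m.+1)%N).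
by exists (Tagged (fun l : 'I_m.+1 => 'I_(size (signs D l)))
  (Ordinal (hp : (p < size (signs D i))%N))).
Qed.

Lemma place_lt (x : point D) : (place x < width (lev x))%N.
Proof. by case: x => [l p]; apply: ltn_ord p. Qed.

Lemma lev_le (x : point D) : (lev x <= m)%N.
Proof. exact: ltn_ord (tag x). Qed.

Variable al : vertex D.

Definition piece (l : 'I_m) : flat := resolve (slice_at D l) (l \in al).

Lemma fits_piece l : fits (piece l) (width l) (width l.+1).
Proof. exact/act_fits/act_signs. Qed.

Notation dart := (point D * bool)%type.
Definition rev_dart (d : dart) : dart := (d.1, ~~ d.2).

Lemma rev_dartK : involutive rev_dart.
Proof. by case=> x s; rewrite /rev_dart /= negbK. Qed.

(** A counterclockwise dart at level l enters slice l at a bottom end, a clockwise one at level l +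
    1 enters it at a top end. Hence the side [~~ d.2] where the slice is entered and [d'.2] where it
    is left. *)
Variant step_spec (d d' : dart) : Prop :=
  | StepArc (l : 'I_m) of lev d.1 = (l + ~~ d.2)%N & lev d'.1 = (l + d'.2)%N
      & (d'.2, place d'.1) = mate (piece l) (~~ d.2, place d.1)
  | StepCut of d'.2 = d.2 & place d.1 = place d'.1
      & lev d.1 = (if d.2 then m else 0)%N & lev d'.1 = (if d.2 then 0 else m)%N.

Lemma stepP d d' : reflect (step_spec d d') (step al d d').
Proof.
case: d d' => [x s] [y s']; rewrite /step; apply: (iffP orP) => [[]|].
- case/existsP=> l /and3P[/eqP h1 /eqP h2]; rewrite arcE => /eqP h3.
  exact: (@StepArc _ _ l).
- by case/and4P=> /eqP h1 /eqP h2 /eqP h3 /eqP h4; apply: StepCut.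
case=> [l h1 h2 h3|h1 h2 h3 h4]; [left|right].
  by apply/existsP; exists l; apply/and3P; split; rewrite ?arcE; apply/eqP.
by apply/and4P; split; apply/eqP.
Qed.

(** Arcs and the cut never compete: the cut is crossed upwards from level m or downwards from level
    0, where no slice remains to be entered. *)
Lemma step_fun d d1 d2 : step al d d1 -> step al d d2 -> d1 = d2.
Proof.
case: d d1 d2 => [x s] [y1 s1] [y2 s2].
move=> /stepP p1 /stepP; case: p1 => [l /= a1 a2 a3|/= a1 a2 a3 a4] [k /= b1 b2 b3|/= b1 b2 b3 b4].
- have E : l = k by apply: val_inj => /=; lia.
  subst k; move: b3; rewrite -a3 => -[E1 E2]; subst s2; congr pair.
  by apply: point_eq; lia.
- by case: s a1 b3 {a3 b1 b4} => /=; have := ltn_ord l; lia.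
- by case: s b1 a3 {b3 a1 a4} => /=; have := ltn_ord k; lia.
by subst s1 s2; congr pair; apply: point_eq; lia.
Qed.

Lemma in_range_piece (l : 'I_m) (d : dart) : lev d.1 = (l + ~~ d.2)%N ->
  in_range (width l) (width l.+1) (~~ d.2, place d.1).
Proof.
case: d => x s /= h; rewrite /in_range /=; have := place_lt x; rewrite h.
by case: s {h} => /=; rewrite ?addn0 ?addn1.
Qed.

Lemma step_total (d : dart) : exists d', step al d d'.
Proof.
have [h1|/eqP h] := lev d.1 =P (if d.2 then m else 0)%N.
  have [y [hy1 hy2]] : exists y : point D,
      lev y = (if d.2 then 0 else m)%N /\ place y = place d.1.
    apply: exists_point; first by case: (d.2).
    have := place_lt d.1; rewrite h1; case: (d.2) => //.
      by rewrite width_last.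
    by rewrite width_last.
  by exists (y, d.2); apply/stepP/StepCut.
have [l hl] : exists l : 'I_m, lev d.1 = (l + ~~ d.2)%N.
  move: h; have := lev_le d.1; case: (d.2) => /= h1 h2.
    have h3 : (lev d.1 < m)%N by rewrite ltn_neqAle h2.
    by exists (Ordinal h3); rewrite /= addn0.
  case E : (lev d.1) h1 h2 => [|k] // h1 _.
  by exists (Ordinal h1); rewrite /= addn1.
have := mate_range (fits_piece l) (in_range_piece hl).
case E : (mate _ _) => [s' p'] hr.
have [y [hy1 hy2]] : exists y : point D, lev y = (l + s')%N /\ place y = p'.
  apply: exists_point; first by have := ltn_ord l; case: (s'); lia.
  by move: hr; rewrite /in_range /=; case: (s') => /=; rewrite ?addn0 ?addn1.
by exists (y, s'); apply/stepP; apply: (StepArc hl) => //; rewrite E /= hy2.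
Qed.

Lemma step_rev d d' : step al d d' -> step al (rev_dart d') (rev_dart d).
Proof.
case/stepP=> [l h1 h2 h3|h1 h2 h3 h4]; apply/stepP; last first.
  by apply: StepCut; rewrite /= ?h1 //; case: (d.2) h3 h4.
apply: (@StepArc _ _ l); [by rewrite /= negbK|by []|].
change ((~~ d.2, place d.1) = mate (piece l) (~~ ~~ d'.2, place d'.1)).
by rewrite negbK h3 (mateK (fits_piece l)) // in_range_piece.
Qed.

Lemma step_neq_rev d : ~~ step al d (rev_dart d).
Proof.
apply/stepP=> -[l _ _ h|/= h _ _ _]; last by case: (d.2) h.
by have := mate_neq (piece l) (~~ d.2, place d.1); rewrite -h eqxx.
Qed.

(** By [step_total] the default is never taken. *)
Definition nxt (d : dart) : dart := odflt d [pick d' | step al d d'].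

Lemma stepE d d' : step al d d' = (nxt d == d').
Proof.
rewrite /nxt; case: pickP => [d1 h1|h] /=; last first.
  by have [d1] := step_total d; rewrite h.
by apply/idP/eqP => [/(step_fun h1)|<-].
Qed.

Lemma nxt_rev d : nxt (rev_dart (nxt d)) = rev_dart d.
Proof. by apply/eqP; rewrite -stepE step_rev // stepE. Qed.

Lemma nxt_inj : injective nxt.
Proof.
move=> d1 d2 E; apply: (can_inj rev_dartK).
by rewrite -(nxt_rev d1) -(nxt_rev d2) E.
Qed.

Lemma connectE d d' : connect (step al) d d' = fconnect nxt d d'.
Proof. by apply: eq_connect => {}d {}d'; rewrite stepE. Qed.

Lemma rev_iter_nxt k d : rev_dart d = iter k nxt (rev_dart (iter k nxt d)).
Proof.
elim: k d => [|k IHk] d //; rewrite -{1}(nxt_rev d) (IHk (nxt d)) -iterS.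
by rewrite -!iterSr.
Qed.

Lemma fconnect_rev d d' :
  fconnect nxt (rev_dart d) (rev_dart d') = fconnect nxt d d'.
Proof.
have imp a b : fconnect nxt a b -> fconnect nxt (rev_dart a) (rev_dart b).
  move/iter_findex => <-; rewrite fconnect_sym; last exact: nxt_inj.
  by rewrite [X in fconnect _ _ X](rev_iter_nxt (findex nxt a b)) fconnect_iter.
by apply/idP/idP => [/imp|/imp //]; rewrite !rev_dartK.
Qed.

(** Folding a path from [d] to its reverse at its middle would yield a dart that
    steps to its own reverse. *)
Lemma nfconnect_rev d : ~~ fconnect nxt d (rev_dart d).
Proof.
apply/negP=> /iter_findex; move: (findex _ _ _) => n.
elim/ltn_ind: n d => -[|[|n]] IHn d /=.
- by case: d => x []; case.
- by move/eqP; rewrite -stepE (negbTE (step_neq_rev d)).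
move=> h; apply: (IHn n _ (nxt d)); first by lia.
by apply: nxt_inj; rewrite nxt_rev -h -iterS -iterSr.
Qed.


End Geometry.

(** * Twisted labelings and circles *)

Section Circles.
Variables (D : diagram) (al : vertex D).
Notation m := (size (word D)).
Notation dart := (point D * bool)%type.
Notation nxt := (nxt al).
Implicit Types (x y : point D) (d : dart).

Lemma circleP x y :
  reflect (exists s, fconnect nxt (x, true) (y, s)) (y \in circle al x).
Proof.
rewrite inE; apply: (iffP existsP) => -[s h]; exists s.
  by rewrite -connectE.
by rewrite connectE.
Qed.

Lemma mem_circle x : x \in circle al x.
Proof. by apply/circleP; exists true; apply: connect0. Qed.

Lemma fconnect_sign x y s s' : fconnect nxt (x, s) (y, s') ->
  fconnect nxt (x, true) (y, s == s').
Proof. by case: s; case: s' => // h; rewrite -fconnect_rev. Qed.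

Lemma circle_eq x y : y \in circle al x -> circle al y = circle al x.
Proof.
have sym := fconnect_sym (@nxt_inj D al).
case/circleP=> s hs; apply/setP=> z; apply/circleP/circleP => -[s' hs'].
  exists (s' == s).
  apply: connect_trans hs _; case: (s); first by case: (s') hs'.
  by rewrite -fconnect_rev /rev_dart /=; case: (s') hs'.
exists (s == s').
by apply: (@fconnect_sign y z); apply: connect_trans hs'; rewrite sym.
Qed.

(** Crossing the cut pairs the counterclockwise darts at level m with those at level 0 inside each
    orbit. This reconciles [winding], which counts at level 0, with [shiftat], which charges
    counterclockwise darts at level m. *)
Lemma card_cut x s :
  #|[set y | (lev y == m) && fconnect nxt (x, s) (y, true)]| =
  #|[set y | (lev y == 0%N) && fconnect nxt (x, s) (y, true)]|.
Proof.
have cutE y : lev y = m -> exists y', nxt (y, true) = (y', true) /\ lev y' = 0%N.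
  move=> hy; have : step al (y, true) (nxt (y, true)) by rewrite stepE.
  case/stepP=> [l /= h _ _|].
    by have := ltn_ord l; rewrite addn0 in h; rewrite -h hy ltnn.
  by case: (nxt (y, true)) => y' s' /= -> _ _ h; exists y'.
set S := [set y | _]; rewrite -(card_in_imset (f := fun y => (nxt (y, true)).1) (D := S)).
  congr #|pred_of_set _|; apply/setP=> y; rewrite inE; apply/imsetP/andP => [[z]|[/eqP hy hxy]].
    rewrite inE => /andP[/eqP/cutE[z' [Ez hz']] h] ->.
    rewrite Ez /= hz' eqxx -Ez; split=> //; apply: connect_trans h _.
    exact: fconnect1.
  have hz : nxt (finv nxt (y, true)) = (y, true) by rewrite f_finv //; apply: nxt_inj.
  have : step al (finv nxt (y, true)) (y, true) by rewrite stepE hz.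
  case/stepP=> [l _ /= h|/= h1 h2]; first by have := ltn_ord l; rewrite hy addn1 in h.
  move: hz h1; case: (finv _ _) => z sz /= hz Esz; subst sz => h3 _.
  exists z; last by rewrite hz.
  by rewrite inE h3 eqxx (same_fconnect1_r (@nxt_inj D al)) hz.
move=> y1 y2; rewrite !inE => /andP[/eqP/cutE[z1 [E1 _]] _] /andP[/eqP/cutE[z2 [E2 _]] _].
by rewrite E1 E2 /= => E;
  have /(@nxt_inj D al)[] : nxt (y1, true) = nxt (y2, true) by rewrite E1 E2 E.
Qed.

Definition passes x s : nat := #|[set y | (lev y == 0%N) && fconnect nxt (x, true) (y, s)]|.

Lemma windingE x : winding al x = (passes x true)%:Z - (passes x false)%:Z.
Proof.
have E s : \sum_(y : point D | lev y == 0%N) (connect (step al) (x, true) (y, s))%:R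
    = (passes x s)%:Z.
  rewrite -[RHS]natz /passes -sum1_card natr_sum big_mkcond [RHS]big_mkcond.
  apply: eq_bigr => y _; rewrite inE connectE.
  by case: (lev y == _) => //=; case: (fconnect _ _ _).
by rewrite /winding sumrB !E.
Qed.

(** M is a period of [g], so that M - 1 iterates invert it; N divides every n for which the n-th
    iterate has a fixed point. The two agree for [succZ], while for [swapZ] M is twice N. *)
Variables (X : finType) (g : X -> X) (M N : nat).
Hypothesis M_gt0 : (0 < M)%N.
Hypothesis gM : forall z, iter M g z = z.
Hypothesis gN : forall n z, iter n g z = z -> (N %| n)%N.
Hypothesis N_large : (#|point D| < N)%N.
Variable x0 : X.

(** The shift [M.-1] stands for the inverse of [g]. *)
Definition shiftat d : nat :=
  if d.2 then (if lev d.1 == m then M.-1 else 0) else (lev d.1 == 0%N).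

Definition good (f : {ffun point D -> X}) : bool :=
  [forall d, f (nxt d).1 == iter (shiftat d) g (f d.1)].

Definition total d n : nat := \sum_(i < n) shiftat (iter i nxt d).

Lemma totalS d n : total d n.+1 = (total d n + shiftat (iter n nxt d))%N.
Proof. by rewrite /total big_ord_recr. Qed.

Lemma good_iter f d n : good f ->
  f (iter n nxt d).1 = iter (total d n) g (f d.1).
Proof.
move/forallP=> hf; elim: n => [|n IHn]; first by rewrite /total big_ord0.
by rewrite /= (eqP (hf _)) IHn -iterD totalS addnC.
Qed.

(** Modulo M, the exponent of [g] collected in one turn is minus the winding number, because M - 1
    stands for -1. *)
Lemma total_order x :
  total (x, true) (order nxt (x, true)) = (M.-1 * passes x true + passes x false)%N.
Proof.
(* A turn visits each dart of the orbit exactly once. *)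
have -> : total (x, true) (order nxt (x, true)) =
    (\sum_(d | fconnect nxt (x, true) d) shiftat d)%N.
  rewrite [RHS](eq_bigl (mem (orbit nxt (x, true)))); last first.
    by move=> d; rewrite fconnect_orbit.
  rewrite -big_uniq ?orbit_uniq //= (big_nth (x, true)) size_orbit big_mkord.
  by apply: eq_bigr => i _; rewrite nth_traject.
rewrite (eq_bigr (fun d => shiftat (d.1, d.2))); last by case.
rewrite (eq_bigl (fun d => true && fconnect nxt (x, true) (d.1, d.2))); last by case.
rewrite -(pair_big_dep xpredT (fun y s => fconnect nxt (x, true) (y, s))
  (fun y s => shiftat (y, s))) /=.
rewrite (eq_bigr (fun y => (fconnect nxt (x, true) (y, true) : nat) * shiftat (y, true)
   + (fconnect nxt (x, true) (y, false) : nat) * shiftat (y, false))%N); last first.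
  move=> y _; rewrite big_mkcond big_bool /=.
  by do 2 case: (fconnect _ _ _); rewrite ?mul1n ?mul0n.
rewrite big_split /= /passes -card_cut; congr addn.
  rewrite -sum1_card big_distrr [RHS]big_mkcond /=; apply: eq_bigr => y _.
  rewrite inE /shiftat /=; case: (lev y == m) => /=; last by rewrite muln0.
  by case: (fconnect _ _ _); rewrite ?mul1n ?muln1.
rewrite -sum1_card [RHS]big_mkcond /=; apply: eq_bigr => y _.
by rewrite inE /shiftat /=; case: (lev y == _); case: (fconnect _ _ _).
Qed.

Lemma gM_dvd : (N %| M)%N.
Proof. exact/(@gN M x0)/gM. Qed.

Lemma iterM k z : iter (M * k) g z = z.
Proof. by elim: k z => [|k IHk] z; rewrite ?muln0 // mulnS iterD IHk gM. Qed.

(** A full turn fixes the label of x, so N divides the winding number. The passages in either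
    direction number at most [#|point D|], which is less than N, so the winding number vanishes. *)
Lemma good_winding f x : good f -> winding al x = 0.
Proof.
move=> hf; have := good_iter (x, true) (order nxt (x, true)) hf.
rewrite iter_order; last exact: nxt_inj.
rewrite total_order /= => /esym/gN hd.
have bound s : (passes x s <= #|point D|)%N by apply: max_card.
have hM : (M.-1.+1 = M)%N by rewrite prednK.
rewrite windingE; set a := passes x true in hd *; set b := passes x false in hd *.
have ha : (a <= #|point D|)%N by apply: bound.
have hb : (b <= #|point D|)%N by apply: bound.
have hMa : (N %| M * a)%N by rewrite dvdn_mulr ?gM_dvd.
have EMa : (M * a = M.-1 * a + a)%N by rewrite -{1}hM mulSn addnC.
suff -> : a = b by rewrite subrr.
have [hab|hab|//] := ltngtP a b.
  have : (N %| b - a)%N.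
    rewrite -(dvdn_addr _ hMa); move: hd; congr (N %| _)%N; lia.
  by move/dvdn_leq; lia.
have : (N %| a - b)%N.
  rewrite -(dvdn_addr _ hd); move: hMa; congr (N %| _)%N; lia.
by move/dvdn_leq; lia.
Qed.

(** A base point on each circle. It is picked from the set [circle al x], so all points of a circle
    receive the same one. *)
Definition rep x : point D := odflt x [pick y in circle al x].

Lemma rep_in x : rep x \in circle al x.
Proof. by rewrite /rep; case: pickP => //= /(_ x); rewrite mem_circle. Qed.

Lemma rep_eq x y : y \in circle al x -> rep y = rep x.
Proof.
move=> h; rewrite /rep (circle_eq h).
by case: pickP => // /(_ x); rewrite mem_circle.
Qed.

Lemma circle_rep x : circle al (rep x) = circle al x.
Proof. exact/circle_eq/rep_in. Qed.

Lemma in_rep x : x \in circle al (rep x).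
Proof. by rewrite circle_rep mem_circle. Qed.

Definition base_dart x : dart := (rep x, true).
(** The direction in which the circle, oriented by its base dart, passes through x; by
    [nfconnect_rev] only one direction occurs. *)
Definition sgn x : bool := fconnect nxt (base_dart x) (x, true).

Lemma fconnect_sgn x s : fconnect nxt (base_dart x) (x, s) = (s == sgn x).
Proof.
have sym := fconnect_sym (@nxt_inj D al).
have excl : fconnect nxt (base_dart x) (x, true) ->
            fconnect nxt (base_dart x) (x, false) -> False.
  rewrite sym => h1 h2; have := nfconnect_rev al (x, true).
  by rewrite (connect_trans h1 h2).
have /circleP[s' hs'] := in_rep x.
rewrite /sgn; case: s.
  by case: (fconnect _ _ _).
case h1: (fconnect _ _ (x, true)).
  by case h2: (fconnect _ _ (x, false)) => //; have := excl h1 h2.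
by case: s' hs' => //; rewrite -/(base_dart x) h1.
Qed.

Definition height x : nat := total (base_dart x) (findex nxt (base_dart x) (x, sgn x)).

Definition mklab (mu : {set point D} -> X) : {ffun point D -> X} :=
  [ffun x => iter (height x) g (mu (circle al x))].

Hypothesis winding0 : forall x, winding al x = 0.

Lemma total_order0 x z : iter (total (x, true) (order nxt (x, true))) g z = z.
Proof.
rewrite total_order; have /eqP := winding0 x; rewrite windingE subr_eq0 => /eqP[<-].
by rewrite addnC -mulSn prednK // iterM.
Qed.

Lemma shift_rev d z : iter (shiftat d) g (iter (shiftat (rev_dart (nxt d))) g z) = z.
Proof.
have : step al d (nxt d) by rewrite stepE.
case: d => x s; case/stepP=> [l|]; last first.
  case: (nxt _) => y s' /= -> _; rewrite /shiftat /rev_dart /=.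
  by case: s => /= -> ->; rewrite !eqxx -iterD ?addn1 ?add1n prednK.
case: (nxt _) => y s' /= h1 h2 _; rewrite /shiftat /rev_dart /=.
have hl : (l == m :> nat) = false by apply: ltn_eqF.
by case: s h1; case: s' h2 => /= -> ->; rewrite ?addn0 ?addn1 ?hl.
Qed.

(** Labels are transported from the base point along the circle. The only closing condition arises
    at the end of the turn, where winding number 0 makes the total twist trivial. *)
Lemma mklab_good mu : good (mklab mu).
Proof.
apply/forallP=> d; apply/eqP.
(* A dart against the chosen orientation is followed by the reverse of a dart along it, and
   [shift_rev] says that the two shifts are inverse. *)
suff main x : mklab mu (nxt (x, sgn x)).1 =
              iter (shiftat (x, sgn x)) g (mklab mu x).
  case: d => x s; have [->|hs] := eqVneq s (sgn x); first exact: main.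
  set d := (x, s); set y := (nxt d).1.
  have Ed : nxt (rev_dart (nxt d)) = (x, sgn x).
    by rewrite nxt_rev /rev_dart /=; congr pair; move: hs; case: (s); case: sgn.
  have Es : rev_dart (nxt d) = (y, sgn y).
    rewrite /y; case: (nxt d) Ed => {}y s' Ed /=; congr pair.
    have hy : y \in circle al x.
      rewrite (_ : circle al x = circle al y) ?mem_circle //; apply: circle_eq.
      apply/circleP; exists (~~ s' == sgn x); apply: fconnect_sign.
      by rewrite -Ed fconnect1.
    apply/eqP; rewrite -fconnect_sgn /base_dart (rep_eq hy).
    by rewrite (same_fconnect1_r (@nxt_inj D al)) Ed fconnect_sgn.
  have := main y; rewrite -Es Ed /= => ->.
  by rewrite shift_rev.
case Ey : (nxt (x, sgn x)) => [y s] /=.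
have hx : fconnect nxt (base_dart x) (x, sgn x) by rewrite fconnect_sgn.
have hy : fconnect nxt (base_dart x) (y, s).
  by rewrite -Ey -(same_fconnect1_r (@nxt_inj D al)).
have yx : y \in circle al x.
  by rewrite -circle_rep; apply/circleP; exists s.
have Es : s = sgn y.
  by apply/eqP; rewrite -fconnect_sgn /base_dart (rep_eq yx).
rewrite !ffunE (circle_eq yx) /height -Es /base_dart (rep_eq yx) -/(base_dart x) -Ey.
rewrite -iterD.
set n := findex _ _ (x, _); set z := mu _.
have En : iter n nxt (base_dart x) = (x, sgn x) by apply: iter_findex.
have -> : (shiftat (x, sgn x) + total (base_dart x) n)%N = total (base_dart x) n.+1.
  by rewrite totalS En addnC.
have hn : (n < order nxt (base_dart x))%N by apply: findex_max.
(* Either the next dart has the next index, or the turn closes at the base dart, whose index is 0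
   and not the order. *)
rewrite -En -iterS; have [hn'|] := ltnP n.+1 (order nxt (base_dart x)).
  by rewrite findex_iter.
move=> hn'; have -> : n.+1 = order nxt (base_dart x) by apply/eqP; rewrite eqn_leq hn.
rewrite iter_order ?findex0; last exact: nxt_inj.
by rewrite total_order0 /total big_ord0.
Qed.

Lemma good_eq f x : good f -> f x = iter (height x) g (f (rep x)).
Proof.
move=> hf; have := good_iter (base_dart x) (findex nxt (base_dart x) (x, sgn x)) hf.
by rewrite iter_findex ?fconnect_sgn.
Qed.

Lemma mklab_rep mu x : mklab mu (rep x) = mu (circle al x).
Proof.
have E : base_dart (rep x) = base_dart x by rewrite /base_dart (rep_eq (rep_in x)).
have Es : sgn (rep x) = true by rewrite /sgn E connect0.
by rewrite ffunE circle_rep /height E Es findex0 /total big_ord0.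
Qed.

Definition rep_val (f : {ffun point D -> X}) (C : {set point D}) : X :=
  if [pick y in C] is Some y then f y else x0.

Lemma rep_val_circle f x : rep_val f (circle al x) = f (rep x).
Proof.
rewrite /rep_val /rep; case: pickP => //= /(_ x).
by rewrite mem_circle.
Qed.

(** Restriction to the base points is a bijection onto the functions on circles, with inverse
    [mklab]. Off [circles al], [phi] takes the value [x0], which makes its image a [pffun_on] of
    known cardinality. *)
Lemma card_good : #|[set f | good f]| = (#|X| ^ #|circles al|)%N.
Proof.
pose phi (f : {ffun point D -> X}) : {ffun {set point D} -> X} :=
  [ffun C => if C \in circles al then rep_val f C else x0].
have phi_circle f x : phi f (circle al x) = f (rep x).
  by rewrite ffunE rep_val_circle ifT // /circles imset_f.
rewrite -(card_pffun_on x0 (mem (circles al)) (mem X)).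
have im : [set phi f | f in [set f | good f]] =i
          pffun_on x0 (mem (circles al)) (mem X).
  move=> h; apply/imsetP/pffun_onP => [[f _ ->]|[h1 _]].
    split=> //; apply/subsetP=> C; rewrite !inE ffunE.
    by case: (C \in circles al) => //; rewrite eqxx.
  exists (mklab h); first by rewrite inE mklab_good.
  apply/ffunP=> C; have [/imsetP[x _ ->]|hC] := boolP (C \in circles al).
    by rewrite phi_circle mklab_rep.
  rewrite ffunE (negbTE hC); apply/eqP; apply: contraNT hC => hC.
  by move/subsetP: h1; apply; rewrite inE.
rewrite -(eq_card im) card_in_imset // => f1 f2; rewrite !inE => h1 h2 E.
apply/ffunP=> x; rewrite (good_eq x h1) (good_eq x h2); congr iter.
by rewrite -!phi_circle E.
Qed.

End Circles.

(** * Sequences of label words as paths *)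

Section Paths.
Variable X : finType.

Fixpoint fpaths (w : seq flat) (s : seq X) : seq (seq (seq X)) :=
  if w is f :: w' then [seq r :: p | r <- nexts f s, p <- fpaths w' r]
  else [:: [::]].

Lemma fops_paths (R : nmodType) w (F : seq X -> R) s :
  fops w F s = \sum_(p <- fpaths w s) F (last s p).
Proof.
elim: w s => [|f w IHw] s /=; first by rewrite big_seq1.
rewrite big_allpairs_dep; apply: eq_bigr => r _.
by rewrite -IHw.
Qed.

Lemma uniq_fpaths w s k : fitsw w (size s) k -> uniq (fpaths w s).
Proof.
elim: w s => [|f w IHw] s //= [j hf hw]; apply: allpairs_uniq_dep.
- exact: uniq_nexts hf.
- by move=> r hr; apply: IHw; rewrite (size_nexts hf hr).
by move=> [r1 p1] [r2 p2] _ _ /= [-> ->].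
Qed.

Lemma fpathsP w s p :
  reflect (size p = size w /\ forall l, (l < size w)%N ->
             nth [::] p l \in nexts (nth Vert w l) (nth [::] (s :: p) l))
          (p \in fpaths w s).
Proof.
apply: (iffP idP).
  elim: w s p => [|f w IHw] s p /=; first by rewrite inE => /eqP->.
  case/allpairsPdep=> r [p' [hr /IHw[hs hp] ->]]; rewrite /= hs; split=> //.
  by case=> [|l] //=; rewrite ltnS => /hp.
elim: w s p => [|f w IHw] s [|r p] [] //= [hs] hp.
apply/allpairsPdep; exists r, p; split=> //; first exact: (hp 0%N).
by apply: IHw; split=> // l hl; apply: (hp l.+1).
Qed.

End Paths.

(** * Good labelings counted by the trace *)

Section CountLabelings.
Variables (D : diagram) (al : vertex D).
Notation m := (size (word D)).
Variables (X : finType) (g : X -> X) (M : nat) (x0 : X).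
Hypothesis M_gt0 : (0 < M)%N.
Hypothesis gM : forall z, iter M g z = z.
Implicit Type f : {ffun point D -> X}.

Definition flats : seq flat := [seq piece al l | l <- enum 'I_m].

Lemma nth_flats (l : 'I_m) : nth Vert flats l = piece al l.
Proof.
by rewrite (nth_map l) ?size_enum_ord // nth_ord_enum.
Qed.

Lemma size_flats : size flats = m.
Proof. by rewrite size_map size_enum_ord. Qed.

Lemma fitsw_seq w (k : nat -> nat) :
  (forall l, (l < size w)%N -> fits (nth Vert w l) (k l) (k l.+1)) ->
  fitsw w (k 0%N) (k (size w)).
Proof.
elim: w k => [|f w IHw] k //= hw; exists (k 1%N); first exact: (hw 0%N).
by apply: (IHw (k \o S)) => l hl; apply: (hw l.+1).
Qed.

Lemma fitsw_flats : fitsw flats (width D 0) (width D 0).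
Proof.
have := @fitsw_seq flats (width D); rewrite size_flats width_last; apply=> l hl.
by rewrite (nth_flats (Ordinal hl)); apply: fits_piece.
Qed.

Definition val_at f (l p : nat) : X :=
  if [pick x | (lev x == l) && (place x == p)] is Some x then f x else x0.

Lemma val_at_point f x : val_at f (lev x) (place x) = f x.
Proof.
rewrite /val_at; case: pickP => [y /andP[/eqP h1 /eqP h2]|/(_ x)].
  by rewrite (point_eq h1 h2).
by rewrite !eqxx.
Qed.

Definition row f l : seq X := mkseq (val_at f l) (width D l).

Lemma size_row f l : size (row f l) = width D l.
Proof. exact: size_mkseq. Qed.

Lemma nth_row f x : nth x0 (row f (lev x)) (place x) = f x.
Proof. by rewrite nth_mkseq ?val_at_point // place_lt. Qed.

Lemma row_inj f1 f2 : (forall l, (l <= m)%N -> row f1 l = row f2 l) -> f1 = f2.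
Proof.
by move=> h; apply/ffunP=> x; rewrite -!nth_row h // lev_le.
Qed.

Lemma shiftat_arc (l : 'I_m) (d : point D * bool) :
  lev d.1 = (l + ~~ d.2)%N -> shiftat M d = 0%N.
Proof.
have hl : (l == m :> nat) = false by apply: ltn_eqF.
by case: d => x []; rewrite /shiftat /= => ->; rewrite ?addn0 ?addn1 ?hl.
Qed.

Lemma elabel_row f (l : 'I_m) x (s : bool) : lev x = (l + s)%N ->
  elabel x0 (row f l) (row f l.+1) (s, place x) = f x.
Proof. by rewrite -(nth_row f x) => ->; case: s; rewrite ?addn0 ?addn1. Qed.

(** The condition on darts splits: inside the slices it says that consecutive rows are transitions,
    across the cut it is the twist. The two directions across the cut give the same equation, since
    M - 1 iterates invert [g]. *)
Lemma goodP f :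
  good al g M f <->
  (forall l : 'I_m, row f l.+1 \in nexts (piece al l) (row f l)) /\
  row f m = map g (row f 0).
Proof.
split=> [/forallP hf|[hn hc]].
  split=> [l|].
    apply: (@mem_nexts X x0 (piece al l) (row f l) (row f l.+1)); rewrite ?size_row;
      first exact: fits_piece.
    case=> b q he.
    have [x [hx hq]] : exists x : point D, lev x = (l + b)%N /\ place x = q.
      apply: exists_point; first by have := ltn_ord l; case: (b); lia.
      by move: he; rewrite /in_range /=; case: (b); rewrite ?addn0 ?addn1.
    have hx' : lev x = (l + ~~ ~~ b)%N by rewrite negbK.
    subst q; rewrite (elabel_row f hx).
    have := hf (x, ~~ b); rewrite (shiftat_arc (d := (x, ~~ b)) hx') => /eqP.
    have : step al (x, ~~ b) (nxt al (x, ~~ b)) by rewrite stepE.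
    case/stepP=> [k h1 h2 h3|_ _ /= h1 _].
      have Ek : k = l by apply: val_inj => /=; move: h1 => /=; lia.
      subst k; move: h3 h2; case: (nxt _ _) => y s' h3 h2 Ef.
      move: h3; rewrite negbK => <-.
      by rewrite (elabel_row f h2).
    move: h1; rewrite hx; have := ltn_ord l; case: (b); rewrite ?addn0 ?addn1 //=.
    by move=> /[swap] ->; rewrite ltnn.
  apply: (eq_from_nth (x0 := x0)); first by rewrite size_map !size_row width_last.
  move=> p; rewrite size_row width_last => hp.
  have [x [hx hq]] := exists_point (leq0n m) hp.
  have := hf (x, false); rewrite /shiftat /= hx eqxx => /eqP.
  have : step al (x, false) (nxt al (x, false)) by rewrite stepE.
  case/stepP=> [k /= h1|_ /= h1 _ h2]; first by move: h1; rewrite hx addn1.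
  rewrite -(nth_row f (nxt _ _).1) h2 -h1 hq => ->.
  have -> : f x = nth x0 (row f 0) p by rewrite -hq -hx nth_row.
  by rewrite (nth_map x0) ?size_row.
apply/forallP=> d; apply/eqP.
have : step al d (nxt al d) by rewrite stepE.
case/stepP=> [l h1 h2 h3|h1 h2 h3 h4].
  rewrite (shiftat_arc h1) -(elabel_row f h1) -(elabel_row f h2) h3 /=.
  by apply/esym/mem_nexts_mate; rewrite ?size_row ?fits_piece.
have E (x y : point D) : lev x = m -> lev y = 0%N -> place x = place y -> f x = g (f y).
  move=> hx hy hxy; rewrite -nth_row -(nth_row f y) hx hy hc hxy (nth_map x0) //.
  by rewrite size_row -hy place_lt.
rewrite /shiftat; case: (d.2) h3 h4 => h3 h4; rewrite h3 eqxx /=.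
  by rewrite (E _ _ h3 h4 h2) -iterSr prednK.
exact: E.
Qed.

Definition row_tuple f l : (width D l).-tuple X :=
  Tuple (introT eqP (size_row f l)).

Definition trace f : seq (seq X) := mkseq (fun l => row f l.+1) m.

Lemma trace_path f l : (l <= m)%N -> nth [::] (row f 0 :: trace f) l = row f l.
Proof. by case: l => // l hl; rewrite /= nth_mkseq. Qed.

Lemma last_trace f : last (row f 0) (trace f) = row f m.
Proof. by rewrite (last_nth [::]) size_mkseq trace_path. Qed.

Lemma fcount_good : fcount g (width D 0) flats = #|[set f | good al g M f]|.
Proof.
rewrite -sum1_card (partition_big (fun f => row_tuple f 0) xpredT) //=.
rewrite /fcount; apply: eq_bigr => s _.
rewrite fops_paths sum1_card.
(* The paths from [s] that close up with the twist. [trace] omits row 0, which is fixed to be [s] by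
   the partition. *)
pose P := [seq p <- fpaths flats s | last (s : seq X) p == map g s].
transitivity (size P).
  rewrite size_filter -sum1_count [RHS]big_mkcond /=; apply: eq_bigr => p _.
  by case: eqP.
rewrite cardE -(size_map trace).
apply/perm_size/uniq_perm.
- apply/filter_uniq/(@uniq_fpaths _ _ _ (width D 0)).
  by rewrite size_tuple; apply: fitsw_flats.
- rewrite map_inj_in_uniq ?enum_uniq // => f1 f2.
  rewrite !mem_enum => /andP[_ /eqP/(congr1 val) /= E1] /andP[_ /eqP/(congr1 val) /= E2] E.
  by apply: row_inj => l hl; rewrite -(trace_path f1 hl) -(trace_path f2 hl) E E1 E2.
move=> p; rewrite mem_filter; apply/andP/mapP => [[/eqP hp1 /fpathsP[hp2 hp3]]|[f]].
  rewrite size_flats in hp2 hp3.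
  have hsz l : (l <= m)%N -> size (nth [::] ((s : seq X) :: p) l) = width D l.
    elim: l => [|l IHl] hl; first by rewrite size_tuple.
    have := hp3 l hl; rewrite (nth_flats (Ordinal hl)).
    by apply: size_nexts; rewrite IHl ?fits_piece // ltnW.
  pose f := [ffun x : point D => nth x0 (nth [::] ((s : seq X) :: p) (lev x)) (place x)].
  have hrow l : (l <= m)%N -> row f l = nth [::] ((s : seq X) :: p) l.
    move=> hl; apply: (eq_from_nth (x0 := x0)); rewrite size_row ?hsz // => q hq.
    by have [x [<- <-]] := exists_point hl hq; rewrite nth_row ffunE.
  exists f; last first.
    apply: (eq_from_nth (x0 := [::])); first by rewrite size_mkseq.
    by move=> l; rewrite hp2 => hl; rewrite nth_mkseq // hrow.
  rewrite mem_enum; apply/andP; split; last by apply/eqP/val_inj; rewrite /= hrow.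
  rewrite inE; apply/goodP; split=> [l|].
    have := hp3 l (ltn_ord l); rewrite nth_flats hrow // (hrow l) //.
    exact/ltnW/ltn_ord.
  by rewrite hrow // hrow //= -hp1 (last_nth [::]) hp2.
rewrite mem_enum => /andP[]; rewrite inE => /goodP[hn hc] /eqP/(congr1 val) /= Es ->.
split; first by rewrite -Es last_trace hc.
apply/fpathsP; rewrite size_flats size_mkseq; split=> // l hl.
rewrite -Es (nth_flats (Ordinal hl)) trace_path 1?ltnW // nth_mkseq //.
exact: hn (Ordinal hl).
Qed.

End CountLabelings.

Definition trivial_state (D : diagram) (al : vertex D) : bool :=
  [forall x, winding al x == 0].

Lemma fcount_circles (D : diagram) (al : vertex D) (X : finType) (g : X -> X)
    (M N : nat) : (0 < #|X|)%N -> (0 < M)%N ->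
    (forall z, iter M g z = z) ->
    (forall n z, iter n g z = z -> (N %| n)%N) ->
    (#|point D| < N)%N ->
  fcount g (size (base D)) (flats al) =
  (if trivial_state al then #|X| ^ #|circles al| else 0)%N.
Proof.
case/card_gt0P=> x0 _ M_gt0 gM gN N_large.
rewrite -signs0 (fcount_good al x0 M_gt0 gM); case: ifP => [/forallP ht|/negbT].
  by apply: card_good => // x; apply/eqP.
rewrite negb_forall => /existsP[x hx]; apply/eqP; rewrite cards_eq0; apply/eqP/setP=> f.
rewrite !inE; apply/negP=> hf; case/eqP: hx.
exact: (good_winding M_gt0 gM gN N_large x0 x hf).
Qed.

(** * Cyclic labels and the two twists *)

Section CyclicLabels.
Variable N : nat.
Notation Z := 'I_N.+2.

Definition succZ (a : Z) : Z := a + 1.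

Lemma succZ_inj : injective succZ.
Proof. exact: addIr. Qed.

Lemma iter_succZ n a : iter n succZ a = a + n%:R.
Proof.
by elim: n => [|n IHn]; rewrite ?addr0 // iterS IHn /succZ mulrSr addrA.
Qed.

Lemma natZ_eq0 n : (n%:R == 0 :> Z) = (N.+2 %| n)%N.
Proof. by rewrite -(inj_eq val_inj) /= Zp_nat /=. Qed.

Definition swapZ (a : Z * Z) : Z * Z := (a.2, succZ a.1).

Lemma iter_swapZ n a : iter n.*2 swapZ a = (a.1 + n%:R, a.2 + n%:R).
Proof.
elim: n => [|n IHn]; first by rewrite !addr0; case: a.
by rewrite doubleS !iterS IHn /swapZ /succZ /= mulrSr !addrA.
Qed.

Lemma iter_succZ_period a : iter N.+2 succZ a = a.
Proof. by rewrite iter_succZ (eqP (_ : N.+2%:R == 0)) ?addr0 // natZ_eq0. Qed.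

Lemma iter_succZ_fix n a : iter n succZ a = a -> (N.+2 %| n)%N.
Proof. by rewrite iter_succZ -[RHS]addr0 => /addrI/eqP; rewrite natZ_eq0. Qed.

Lemma iter_swapZ_period a : iter (N.+2).*2 swapZ a = a.
Proof.
by rewrite iter_swapZ (eqP (_ : N.+2%:R == 0)) ?addr0 ?natZ_eq0 //; case: a.
Qed.

(** An even iterate translates both components by n / 2. An odd one, n = 2k + 1, fixes (a, b) only
    if a = b + k and b = a + k + 1, and together these give n = 0 modulo N + 2. *)
Lemma iter_swapZ_fix n a : iter n swapZ a = a -> (N.+2 %| n)%N.
Proof.
rewrite -(odd_double_half n); case: (odd n); last first.
  rewrite add0n iter_swapZ -muln2 => E; apply/dvdn_mulr; rewrite -natZ_eq0.
  by move/(congr1 fst): E => /=; rewrite -[RHS]addr0 => /addrI->.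
rewrite add1n iterS iter_swapZ /swapZ /succZ /=.
case: a => a b /= [Ea Eb]; have -> : ((n./2).*2.+1 = n./2 + n./2 + 1)%N by lia.
rewrite -natZ_eq0 !natrD.
by apply/eqP/(addrI b); rewrite addr0 -[RHS]Eb -Ea !addrA.
Qed.

End CyclicLabels.

Lemma fcount_succZ (D : diagram) (al : vertex D) N : (#|point D| < N.+2)%N ->
  fcount (@succZ N) (size (base D)) (flats al) =
  (if trivial_state al then N.+2 ^ #|circles al| else 0)%N.
Proof.
move=> hN; rewrite (fcount_circles al (M := N.+2) (N := N.+2)) ?card_ord //.
  exact: iter_succZ_period.
exact: iter_succZ_fix.
Qed.

Lemma fcount_swapZ (D : diagram) (al : vertex D) N : (#|point D| < N.+2)%N ->
  fcount (@swapZ N) (size (base D)) (flats al) =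
  (if trivial_state al then N.+2 ^ (2 * #|circles al|) else 0)%N.
Proof.
move=> hN; rewrite (fcount_circles al (M := (N.+2).*2) (N := N.+2)) ?card_prod ?card_ord //.
- by rewrite expnM mulnn.
- exact: iter_swapZ_period.
exact: iter_swapZ_fix.
Qed.

(** * The state sum as a trace *)

Definition choices (f : slice) : seq bool :=
  if is_cross f then [:: false; true] else [:: false].

(** Bit sequences aligned with the word can be concatenated and rotated along with it, unlike
    subsets of ['I_m]. *)
Fixpoint masks (w : seq slice) : seq bitseq :=
  if w is f :: w' then [seq b :: bs | b <- choices f, bs <- masks w'] else [:: [::]].

Definition flatw (w : seq slice) (bs : bitseq) : seq flat :=
  [seq resolve p.1 p.2 | p <- zip w bs].

Lemma big_masks (R : nmodType) f w (F : bitseq -> R) :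
  \sum_(bs <- masks (f :: w)) F bs =
  \sum_(b <- choices f) \sum_(bs <- masks w) F (b :: bs).
Proof. exact: big_allpairs_dep. Qed.

Lemma big_masks_cat (R : nmodType) u v (F : bitseq -> R) :
  \sum_(bs <- masks (u ++ v)) F bs =
  \sum_(b1 <- masks u) \sum_(b2 <- masks v) F (b1 ++ b2).
Proof.
elim: u F => [|f u IHu] F; first by rewrite big_seq1.
rewrite cat_cons !big_masks; apply: eq_bigr => b _; exact: IHu.
Qed.

Lemma uniq_masks w : uniq (masks w).
Proof.
elim: w => [|f w IHw] //=; apply: allpairs_uniq => //; last first.
  by move=> [b1 s1] [b2 s2] _ _ /= [-> ->].
by rewrite /choices; case: ifP.
Qed.

Lemma masksP w bs :
  reflect (size bs = size w /\
           forall l, nth false bs l -> is_cross (nth (Cap 0) w l))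
          (bs \in masks w).
Proof.
apply: (iffP idP).
  elim: w bs => [|f w IHw] bs /=; first by rewrite inE => /eqP->; split=> // -[].
  case/allpairsP=> -[b bs'] /= [hb /IHw[hs hn] ->]; split; first by rewrite /= hs.
  case=> [|l] /=; last exact: hn.
  by move: hb; rewrite /choices; case: ifP; rewrite ?inE => // _ /eqP->.
elim: w bs => [|f w IHw] [|b bs] [] //= [hs] hn; apply/allpairsP; exists (b, bs).
split=> //=; last by apply: IHw; split=> // l; apply: (hn l.+1).
by have := hn 0%N; rewrite /choices /=; case: (b) => [/(_ isT)->|_] //; case: ifP.
Qed.

Lemma size_masks w bs : bs \in masks w -> size bs = size w.
Proof. by case/masksP. Qed.

Lemma flatw_cat u v b1 b2 : size b1 = size u ->
  flatw (u ++ v) (b1 ++ b2) = flatw u b1 ++ flatw v b2.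
Proof. by move=> h; rewrite /flatw zip_cat // map_cat. Qed.

Lemma run_cons s f w : run s (f :: w) = obind (run^~ w) (act f s).
Proof.
rewrite /run /=; case: (act f s) => //=.
by elim: w.
Qed.

Lemma fitsw_flatw s w s' bs : run s w = Some s' -> size bs = size w ->
  fitsw (flatw w bs) (size s) (size s').
Proof.
elim: w s bs => [|f w IHw] s [|b bs] //=; first by case=> ->.
rewrite run_cons; case E: (act f s) => [s1|] //=.
move=> hw [hb]; exists (size s1); first exact: act_fits E.
exact: IHw.
Qed.

Section StateMask.
Variable D : diagram.
Notation m := (size (word D)).

Definition mask_state (bs : bitseq) : vertex D := [set l : 'I_m | nth false bs l].

Lemma flats_mask bs : size bs = m -> flats (mask_state bs) = flatw (word D) bs.
Proof.
move=> hs; apply: (eq_from_nth (x0 := Vert)).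
  by rewrite size_flats size_map size_zip hs minnn.
move=> l; rewrite size_flats => hl; rewrite (nth_flats _ (Ordinal hl)).
rewrite (nth_map (Cap 0, false)) ?size_zip ?hs ?minnn // nth_zip //=.
by rewrite /piece inE.
Qed.

Lemma card_mask bs : size bs = m -> #|mask_state bs| = count id bs.
Proof.
move=> hs; rewrite -sum1_card -sum1_count (big_nth false) hs big_mkord.
by apply: eq_bigl => l; rewrite inE.
Qed.

Lemma sum_states (R : nmodType) (F : vertex D -> R) :
  \sum_(al : vertex D | al \subset crossings D) F al =
  \sum_(bs <- masks (word D)) F (mask_state bs).
Proof.
pose enc (al : vertex D) : bitseq := [seq l \in al | l <- enum 'I_m].
have nth_enc al (l : 'I_m) : nth false (enc al) l = (l \in al).
  by rewrite (nth_map l) ?size_enum_ord // nth_ord_enum.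
have encK al : mask_state (enc al) = al.
  by apply/setP=> l; rewrite inE nth_enc.
rewrite -(big_map mask_state xpredT F) -big_enum.
apply: perm_big; apply: uniq_perm; first exact: enum_uniq.
  rewrite map_inj_in_uniq ?uniq_masks // => b1 b2 /size_masks h1 /size_masks h2.
  move=> /setP E; apply: (eq_from_nth (x0 := false)); rewrite h1 ?h2 // => l hl.
  by have := E (Ordinal hl); rewrite !inE.
move=> al; rewrite mem_enum; apply/subsetP/mapP => [h|[bs /masksP[_ hb] -> l]].
  exists (enc al); rewrite ?encK //; apply/masksP.
  rewrite size_map size_enum_ord; split=> // l; have [hl|hl] := ltnP l m.
    by rewrite (nth_enc al (Ordinal hl)) => /h; rewrite inE.
  by rewrite nth_default // size_map size_enum_ord.
by rewrite !inE => /hb.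
Qed.

End StateMask.

Section Operators.
Variables (K : fieldType) (q : K).

Definition uop (X : finType) (f : slice) (F : seq X -> K) (s : seq X) : K :=
  \sum_(b <- choices f) (- q) ^+ b * fop (resolve f b) F s.

Definition uops (X : finType) (w : seq slice) (F : seq X -> K) : seq X -> K :=
  foldr (@uop X) F w.

Lemma uops_cat (X : finType) u v (F : seq X -> K) :
  uops (u ++ v) F = uops u (uops v F).
Proof. exact: foldr_cat. Qed.

Lemma uops_masks (X : finType) w (F : seq X -> K) s :
  uops w F s = \sum_(bs <- masks w) (- q) ^+ count id bs * fops (flatw w bs) F s.
Proof.
elim: w s => [|f w IHw] s; first by rewrite big_seq1 mul1r.
rewrite big_masks /= {1}/uop; apply: eq_bigr => b _.
under [RHS]eq_bigr do rewrite /= exprD -mulrA.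
rewrite -mulr_sumr; congr (_ * _).
transitivity (fop (resolve f b) (fun r => \sum_(bs <- masks w)
   (- q) ^+ count id bs * fops (flatw w bs) F r) s).
  by rewrite /fop; apply: eq_bigr => r _; apply: IHw.
rewrite fop_sum; apply: eq_bigr => bs _.
by rewrite -(fop_additive (h := fun a => _ * a)) ?mulr0 // => a c; rewrite mulrDr.
Qed.

(** Over a diagram these factors multiply to (-1)^(n_-) q^(n_+ - 2 n_-), the normalization of the
    Kauffman bracket in Khovanov's convention. *)
Definition cross_norm (s : seq bool) (f : slice) : K :=
  if f is Cross i c then
    if c == (nth false s i == nth false s i.+1) then q else - q ^- 2
  else 1.

Fixpoint norm (s : seq bool) (w : seq slice) : K :=
  if w is f :: w' then cross_norm s f * norm (odflt [::] (act f s)) w' else 1.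

Lemma norm_cat s s' u v : run s u = Some s' ->
  norm s (u ++ v) = norm s u * norm s' v.
Proof.
elim: u s => [|f u IHu] s /=; first by case=> ->; rewrite mul1r.
rewrite run_cons; case E: (act f s) => [s1|] //=.
by move=> h; rewrite (IHu s1) // mulrA.
Qed.

(** The graded Euler characteristic of the annular complex, with the nontrivial
    circles evaluated to 0. *)
Definition state_sum (D : diagram) : K :=
  norm (base D) (word D) *
  \sum_(al : vertex D | al \subset crossings D)
    (- q) ^+ #|al| *
    (if trivial_state al then (q + q^-1) ^+ #|circles al| else 0).

Definition utrace (X : finType) (g : X -> X) (n : nat) (w : seq slice) : K :=
  \sum_(s : n.-tuple X) uops w (fun r => (r == map g s)%:R) s.

Lemma utrace_masks (X : finType) (g : X -> X) n w :
  utrace g n w =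
  \sum_(bs <- masks w) (- q) ^+ count id bs * (fcount g n (flatw w bs))%:R.
Proof.
rewrite /utrace; under eq_bigr do rewrite uops_masks.
rewrite exchange_big; apply: eq_bigr => bs _; rewrite -mulr_sumr; congr (_ * _).
rewrite /fcount natr_sum; apply: eq_bigr => s _.
rewrite -(fops_additive (h := fun a : nat => a%:R : K)) //.
  by apply: fops_ext => r /=; case: eqP.
by move=> a b; rewrite natrD.
Qed.

Lemma state_sum_utrace (D : diagram) N : (#|point D| < N.+2)%N ->
    q + q^-1 = N.+2%:R ->
  state_sum D = norm (base D) (word D) * utrace (@succZ N) (size (base D)) (word D).
Proof.
move=> hN hq; rewrite /state_sum sum_states utrace_masks; congr (_ * _).
rewrite !big_seq; apply: eq_bigr => bs /size_masks hs.
rewrite card_mask // -flats_mask // fcount_succZ // hq.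
by case: ifP; rewrite ?natrX.
Qed.

Lemma utrace_rot (X : finType) (g : X -> X) s s' u v : injective g ->
    run s u = Some s' -> run s' v = Some s ->
  utrace g (size s) (u ++ v) = utrace g (size s') (v ++ u).
Proof.
move=> g_inj hu hv; rewrite !utrace_masks !big_masks_cat exchange_big.
rewrite !big_seq; apply: eq_bigr => b2 /size_masks h2.
rewrite !big_seq; apply: eq_bigr => b1 /size_masks h1.
rewrite !count_cat addnC !flatw_cat //.
by rewrite (fcount_rot g_inj (fitsw_flatw hu h1) (fitsw_flatw hv h2)).
Qed.

End Operators.

(** * Isotopy invariance *)

Definition fshift (k : nat) (f : flat) : flat :=
  match f with
  | Vert => Vert
  | FlatCup i => FlatCup (k + i)
  | FlatCap i => FlatCap (k + i)
  | CapCup i => CapCup (k + i)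
  end.

Lemma resolve_shift k f b : resolve (shift k f) b = fshift k (resolve f b).
Proof. by case: f => //= i c; case: eqP. Qed.

Lemma choices_shift k f : choices (shift k f) = choices f.
Proof. by case: f. Qed.

Lemma take_window (T : Type) (p x r : seq T) i : (i <= size x)%N ->
  take (size p + i) (p ++ x ++ r) = p ++ take i x.
Proof. by move=> hi; rewrite take_cat ltnNge leq_addr /= addKn takel_cat. Qed.

Lemma drop_window (T : Type) (p x r : seq T) i : (i <= size x)%N ->
  drop (size p + i) (p ++ x ++ r) = drop i x ++ r.
Proof.
move=> hi; rewrite drop_cat ltnNge leq_addr /= addKn drop_cat.
by case: ltngtP hi => // -> _; rewrite subnn drop0 drop_size.
Qed.

Lemma nth_window (T : Type) (t0 : T) (p x r : seq T) i : (i < size x)%N ->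
  nth t0 (p ++ x ++ r) (size p + i) = nth t0 x i.
Proof. by move=> hi; rewrite nth_cat ltnNge leq_addr /= addKn nth_cat hi. Qed.

Definition admits (n : nat) (f : slice) : bool := (pos f + bottom_ends f <= n)%N.

Lemma act_shift f (p x r : seq bool) : admits (size x) f ->
  act (shift (size p) f) (p ++ x ++ r) = omap (fun y => p ++ y ++ r) (act f x).
Proof.
rewrite /admits; case: f => [i b|i|i c] /= hi.
- have hi' : (i <= size x)%N by lia.
  rewrite hi' ifT; last by rewrite !size_cat; lia.
  by rewrite take_window // drop_window //= -!catA.
- have -> : (i.+1 < size x)%N by lia.
  rewrite (_ : (_ < size (p ++ x ++ r))%N); last by rewrite !size_cat; lia.
  rewrite -!addnS !nth_window; try lia.
  by case: ifP => // _ /=; rewrite take_window ?drop_window -?catA; try lia.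
have -> : (i.+1 < size x)%N by lia.
rewrite (_ : (_ < size (p ++ x ++ r))%N); last by rewrite !size_cat; lia.
rewrite -!addnS !nth_window; try lia.
by rewrite take_window ?drop_window /= -?catA; try lia.
Qed.

Lemma size_act f s s' : act f s = Some s' ->
  admits (size s) f /\ (size s' + bottom_ends f = size s + top_ends f)%N.
Proof.
rewrite /admits; case: f => [i b|i|i c] /=; case: ifP => // hi [<-].
- by rewrite !size_cat /= size_drop size_takel //; lia.
- by case/andP: hi => hi _; rewrite size_cat size_drop size_takel //; lia.
by rewrite !size_cat /= size_drop size_takel //; lia.
Qed.

Lemma run_admits f w s s1 : run s (f :: w) = Some s1 ->
  admits (size s) f /\ exists2 s', run s' w = Some s1 &
    (size s' + bottom_ends f = size s + top_ends f)%N.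
Proof.
rewrite run_cons; case E: (act f s) => [s'|] //= h.
by have [h1 h2] := size_act E; split=> //; exists s'.
Qed.

(** * Restriction of a move to a window of strands *)

Section Window.
Variables (K : fieldType) (q : K) (X : finType).
Implicit Types (F : seq X -> K) (x p r ls : seq X).

Lemma cross_norm_shift f (p x r : seq bool) : admits (size x) f ->
  cross_norm q (p ++ x ++ r) (shift (size p) f) = cross_norm q x f.
Proof.
rewrite /admits; case: f => //= i c hi.
by rewrite -!addnS !nth_window //; lia.
Qed.

Lemma nexts_shift f b p x r : admits (size x) f ->
  nexts (fshift (size p) (resolve f b)) (p ++ x ++ r) =
  [seq p ++ y ++ r | y <- nexts (resolve f b) x].
Proof.
have dropS i : (i.+1 < size x)%N -> exists y z t, drop i x = y :: z :: t.
  move=> hi; have := size_drop i x.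
  by case: (drop i x) => [|y [|z t]] /=; [lia|lia|exists y, z, t].
rewrite /admits; case: f => [i o|i|i c] /= hi.
- rewrite take_window ?drop_window; try lia.
  by rewrite -map_comp; apply: eq_map => y /=; rewrite -!catA.
- have [|y [z [t E]]] := dropS i; first by lia.
  rewrite take_window ?drop_window ?E /=; try lia.
  by case: eqP => //= _; rewrite -!catA.
case: eqP => // _ /=.
have [|y [z [t E]]] := dropS i; first by lia.
rewrite take_window ?drop_window ?E /=; try lia.
case: eqP => //= _.
by rewrite -map_comp; apply: eq_map => u /=; rewrite -!catA.
Qed.

Lemma uop_shift f F p x r : admits (size x) f ->
  uop q (shift (size p) f) F (p ++ x ++ r) = uop q f (fun y => F (p ++ y ++ r)) x.
Proof.
move=> hf; rewrite /uop choices_shift; apply: eq_bigr => b _.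
by rewrite resolve_shift /fop nexts_shift // big_map.
Qed.

Lemma eq_uop f (s s' : seq bool) F G x : act f s = Some s' -> size x = size s ->
  (forall y, size y = size s' -> F y = G y) -> uop q f F x = uop q f G x.
Proof.
move=> hf hx eFG; apply: eq_bigr => b _; congr (_ * _).
by apply: (eq_fop (k := size s')) => //; rewrite hx; apply: act_fits hf.
Qed.

Lemma eq_uops w (s s' : seq bool) F G x : run s w = Some s' -> size x = size s ->
  (forall y, size y = size s' -> F y = G y) -> uops q w F x = uops q w G x.
Proof.
elim: w s x => [|f w IHw] s x /=; first by case=> -> hx; apply.
rewrite run_cons; case E: (act f s) => [s1|] //= hw hx eFG.
by apply: (eq_uop E) => // y hy; apply: (IHw s1).
Qed.

Let terms f x : seq (K * seq X) :=
  [seq ((- q) ^+ nat_of_bool b, y) | b <- choices f, y <- nexts (resolve f b) x].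

Let uop_terms f F x : uop q f F x = \sum_(t <- terms f x) t.1 * F t.2.
Proof.
by rewrite big_allpairs_dep; apply: eq_bigr => b _; rewrite /fop mulr_sumr.
Qed.

(** Operators on separate arguments commute: both sides are one finite double sum, taken in the two
    orders. *)
Lemma uop_exchange f g (H : seq X -> seq X -> K) x z :
  uop q f (fun y => uop q g (H y) z) x = uop q g (fun w => uop q f (H^~ w) x) z.
Proof.
rewrite !uop_terms.
under eq_bigr do rewrite uop_terms mulr_sumr.
under [RHS]eq_bigr do rewrite uop_terms mulr_sumr.
by rewrite exchange_big; do 2 apply: eq_bigr => ? _; rewrite mulrCA.
Qed.

(** [F] stands for any continuation, so that the move may be made inside a longer word. [norm] is
    included because the first two Reidemeister moves hold only after normalization. *)
Definition move_ok (a b : seq slice) : Prop :=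
  forall s s1 s2 ls F, run s a = Some s1 -> run s b = Some s2 ->
    size ls = size s ->
  s1 = s2 /\ norm q s a * uops q a F ls = norm q s b * uops q b F ls.

Fixpoint winfits (n : nat) (w : seq slice) : bool :=
  if w is f :: w' then admits n f && winfits (n - bottom_ends f + top_ends f) w'
  else true.

Lemma size_act_winfits f (x y : seq bool) : admits (size x) f -> act f x = Some y ->
  size y = (size x - bottom_ends f + top_ends f)%N.
Proof. by rewrite /admits => h /size_act[_]; lia. Qed.

Lemma run_shift w p x r (s1 : seq bool) sp sx sr :
    size sx = size x -> size sp = size p -> size sr = size r ->
    winfits (size x) w ->
    run (sp ++ sx ++ sr) (map (shift (size p)) w) = Some s1 ->
  exists2 sy, run sx w = Some sy & s1 = sp ++ sy ++ sr.
Proof.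
move=> hx hp hr; rewrite -hx -hp; elim: w sx {hx} => [|f w IHw] sx.
  by move=> _ [<-]; exists sx.
case/andP=> hf hw; rewrite map_cons !run_cons act_shift //.
case E: (act f sx) => [sy|] //= h; apply: IHw h.
by rewrite (size_act_winfits hf E).
Qed.

Lemma norm_shift w (p x r y : seq bool) : winfits (size x) w -> run x w = Some y ->
  norm q (p ++ x ++ r) (map (shift (size p)) w) = norm q x w.
Proof.
elim: w x => [|f w IHw] x //= /andP[hf hw]; rewrite run_cons.
rewrite cross_norm_shift // act_shift //; case E: (act f x) => [x1|] //= hr.
by rewrite IHw ?(size_act_winfits hf E).
Qed.

Lemma uops_shift w (sx sy : seq bool) F p x r :
    size x = size sx -> winfits (size sx) w -> run sx w = Some sy ->
  uops q (map (shift (size p)) w) F (p ++ x ++ r) =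
  uops q w (fun y => F (p ++ y ++ r)) x.
Proof.
elim: w sx x => [|f w IHw] sx x //= hx /andP[hf hw]; rewrite run_cons.
case E: (act f sx) => [s1|] //= hr.
rewrite uop_shift ?hx //; apply: (eq_uop E) => // y hy.
by apply: (IHw s1) => //; rewrite (size_act_winfits hf E).
Qed.

(** Strands outside the window are spectators and are absorbed into [F]. Inside it the orientation
    and label words have length n, so for a concrete n they can be destructed completely. *)
Lemma window_move n i a b : winfits n a -> winfits n b ->
    (forall s s1, run s (map (shift i) a) = Some s1 -> (i + n <= size s)%N) ->
    (forall s s1 s2 x F, size s = n -> size x = n ->
       run s a = Some s1 -> run s b = Some s2 ->
       s1 = s2 /\ norm q s a * uops q a F x = norm q s b * uops q b F x) ->
  move_ok (map (shift i) a) (map (shift i) b).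
Proof.
move=> ha hb hn hab s s1 s2 ls F ra rb hls.
have hs := hn _ _ ra.
have [p [t [Es hp]]] : exists p t : seq bool, s = p ++ t /\ size p = i by apply: splitat; lia.
have [x [r [Et hx]]] : exists x r : seq bool, t = x ++ r /\ size x = n.
  by apply: splitat; move: hs; rewrite Es size_cat; lia.
have [p' [t' [Es' hp']]] : exists p' t', ls = p' ++ t' /\ size p' = i.
  by apply: splitat; lia.
have [x' [r' [Et' hx']]] : exists x' r', t' = x' ++ r' /\ size x' = n.
  by apply: splitat; move: hs; rewrite -hls Es' size_cat; lia.
subst s t ls t'; rewrite -hp in ra rb *.
have hr : size r = size r' by move: hls; rewrite !size_cat; lia.
have hxx : size x = size x' by rewrite hx hx'.
have hpp : size p = size p' by rewrite hp hp'.
have [y1 ry1 ->] : exists2 y1, run x a = Some y1 & s1 = p ++ y1 ++ r.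
  by apply: (@run_shift a p' x' r') => //; rewrite ?hx' -?hpp.
have [y2 ry2 ->] : exists2 y2, run x b = Some y2 & s2 = p ++ y2 ++ r.
  by apply: (@run_shift b p' x' r') => //; rewrite ?hx' -?hpp.
have [E1 E2] := hab _ _ _ x' (fun y => F (p' ++ y ++ r')) hx hx' ry1 ry2.
split; first by rewrite E1.
rewrite (norm_shift _ _ _ ry1) ?hx // (norm_shift _ _ _ ry2) ?hx //.
rewrite hpp (uops_shift _ _ _ _ _ ry1) ?hx //.
by rewrite (uops_shift _ _ _ _ _ ry2) ?hx //.
Qed.

End Window.

(** * Moves in a window, by Temperley-Lieb relations *)

Section LocalMoves.
Variables (K : fieldType) (q : K) (X : finType).
Hypothesis q_neq0 : q != 0.
Hypothesis card_X : #|X|%:R = q + q^-1.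
Implicit Types (F G : seq X -> K) (s : seq X).

Lemma uop_cup i b F s : uop q (Cup i b) F s = fop (FlatCup i) F s.
Proof. by rewrite /uop big_seq1 mul1r. Qed.

Lemma uop_cap i F s : uop q (Cap i) F s = fop (FlatCap i) F s.
Proof. by rewrite /uop big_seq1 mul1r. Qed.

(** The Kauffman skein relation: with e for [CapCup], a crossing acts as 1 - q e or as e - q. *)
Lemma uop_cross i c F s : uop q (Cross i c) F s =
  if c then F s - q * fop (CapCup i) F s else fop (CapCup i) F s - q * F s.
Proof.
rewrite /uop /= big_cons big_seq1 /= mul1r expr1 mulNr.
by case: c; rewrite /= fop_vert.
Qed.

Lemma sum_const (c : K) : \sum_(z : X) c = (q + q^-1) * c.
Proof. by rewrite sumr_const -card_X mulr_natl. Qed.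

Lemma sum_eql x (G : X -> K) : \sum_(z : X) (if x == z then G z else 0) = G x.
Proof. by rewrite -big_mkcond (big_pred1 x) // => z; rewrite eq_sym. Qed.

Lemma sum_eqr x (G : X -> K) : \sum_(z : X) (if z == x then G z else 0) = G x.
Proof. by rewrite -big_mkcond (big_pred1 x). Qed.

Lemma fopB f (c : K) F G s :
  fop f (fun t => F t - c * G t) s = fop f F s - c * fop f G s.
Proof. by rewrite /fop sumrB mulr_sumr. Qed.

Lemma cup0 F s : fop (FlatCup 0) F s = \sum_(z : X) F [:: z, z & s].
Proof. exact: (fop_cup F (p := [::])). Qed.

Lemma cup1 F x s : fop (FlatCup 1) F (x :: s) = \sum_(z : X) F [:: x, z, z & s].
Proof. exact: (fop_cup F (p := [:: x])). Qed.

Lemma cap0 F x y s : fop (FlatCap 0) F [:: x, y & s] = if x == y then F s else 0.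
Proof. exact: (fop_cap F (p := [::])). Qed.

Lemma cap1 F z x y s :
  fop (FlatCap 1) F [:: z, x, y & s] = if x == y then F (z :: s) else 0.
Proof. exact: (fop_cap F (p := [:: z])). Qed.

Lemma capcup0 F x y s : fop (CapCup 0) F [:: x, y & s] =
  if x == y then \sum_(z : X) F [:: z, z & s] else 0.
Proof. exact: (fop_capcup F (p := [::])). Qed.

Lemma capcup1 F u x y s : fop (CapCup 1) F [:: u, x, y & s] =
  if x == y then \sum_(z : X) F [:: u, z, z & s] else 0.
Proof. exact: (fop_capcup F (p := [:: u])). Qed.

(** Temperley-Lieb relation for the square of e: the closed loop is a free sum over q + q^-1
    labels. *)
Lemma capcup_idem F x y s :
  fop (CapCup 0) (fop (CapCup 0) F) [:: x, y & s] =
  (q + q^-1) * fop (CapCup 0) F [:: x, y & s].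
Proof.
rewrite !capcup0; case: eqP => _; last by rewrite mulr0.
by under eq_bigr do rewrite capcup0 eqxx; rewrite sum_const.
Qed.

Lemma capcup_idem1 F u x y s :
  fop (CapCup 1) (fop (CapCup 1) F) [:: u, x, y & s] =
  (q + q^-1) * fop (CapCup 1) F [:: u, x, y & s].
Proof.
rewrite !capcup1; case: eqP => _; last by rewrite mulr0.
by under eq_bigr do rewrite capcup1 eqxx; rewrite sum_const.
Qed.

(** Temperley-Lieb relation straightening a zigzag: the equality tests of the outer operators
    consume the free labels. *)
Lemma capcup010 F x y z s :
  fop (CapCup 0) (fop (CapCup 1) (fop (CapCup 0) F)) [:: x, y, z & s] =
  fop (CapCup 0) F [:: x, y, z & s].
Proof.
rewrite !capcup0; case: eqP => // _.
under eq_bigr => a _.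
  rewrite capcup1; under eq_bigr do rewrite capcup0.
  rewrite (sum_eql a (fun b => \sum_c F [:: c, c, b & s])); over.
exact: (sum_eqr z (fun a => \sum_c F [:: c, c, a & s])).
Qed.

Lemma capcup101 F x y z s :
  fop (CapCup 1) (fop (CapCup 0) (fop (CapCup 1) F)) [:: x, y, z & s] =
  fop (CapCup 1) F [:: x, y, z & s].
Proof.
rewrite !capcup1; case: eqP => // _.
under eq_bigr => a _.
  rewrite capcup0; under eq_bigr do rewrite capcup1.
  rewrite (sum_eqr a (fun b => \sum_c F [:: b, c, c & s])); over.
exact: (sum_eql x (fun a => \sum_c F [:: a, c, c & s])).
Qed.

Lemma eq_fop_ext f F G s : F =1 G -> fop f F s = fop f G s.
Proof. by move=> h; apply: eq_bigr. Qed.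

Lemma move_zigzag_l i b : move_ok q X [:: Cup i.+1 b; Cap i] [::].
Proof.
have -> : [:: Cup i.+1 b; Cap i] = map (shift i) [:: Cup 1 b; Cap 0].
  by rewrite /= addn1 addn0.
apply: (@window_move _ _ _ 1 i _ [::]) => //.
  by move=> s s1 /run_admits[]; rewrite /admits /=; lia.
case=> [|s0 []] // s1 s2 [|x []] //= F _ _; rewrite /run /=.
case: ifP => //= hb [<-] [<-]; split; first by case: s0 b hb => [] [].
rewrite !mulr1 !mul1r uop_cup cup1.
under eq_bigr do rewrite uop_cap cap0.
by rewrite (sum_eql x (fun z => F [:: z])).
Qed.

Lemma move_zigzag_r i b : move_ok q X [:: Cup i b; Cap i.+1] [::].
Proof.
have -> : [:: Cup i b; Cap i.+1] = map (shift i) [:: Cup 0 b; Cap 1].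
  by rewrite /= addn1 addn0.
apply: (@window_move _ _ _ 1 i _ [::]) => //.
  by move=> s s1 /run_admits[_ [s' /run_admits[]]]; rewrite /admits /=; lia.
case=> [|s0 []] // s1 s2 [|x []] //= F _ _; rewrite /run /=.
case: ifP => //= hb [<-] [<-]; split; first by case: s0 b hb => [] [].
rewrite !mulr1 !mul1r uop_cup cup0.
under eq_bigr do rewrite uop_cap cap1.
by rewrite (sum_eqr x (fun z => F [:: z])).
Qed.

Lemma move_slide_cap i c :
  move_ok q X [:: Cross i.+1 c; Cap i] [:: Cross i (~~ c); Cap i.+1].
Proof.
have -> : [:: Cross i.+1 c; Cap i] = map (shift i) [:: Cross 1 c; Cap 0].
  by rewrite /= addn1 addn0.
have -> : [:: Cross i (~~ c); Cap i.+1] = map (shift i) [:: Cross 0 (~~ c); Cap 1].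
  by rewrite /= addn1 addn0.
apply: (@window_move _ _ _ 3 i) => //.
  by move=> s s1 /run_admits[]; rewrite /admits /=; lia.
case=> [|a0 [|a1 [|a2 []]]] // s1 s2 [|x [|y [|z []]]] // F _ _.
have E : uops q [:: Cross 1 c; Cap 0] F [:: x; y; z] =
         uops q [:: Cross 0 (~~ c); Cap 1] F [:: x; y; z].
  rewrite /= !uop_cross !uop_cap !(capcup0, capcup1, cap0, cap1).
  under eq_bigr do rewrite uop_cap cap0.
  rewrite (sum_eql x (fun a => F [:: a])).
  under eq_bigr do rewrite uop_cap cap1.
  by rewrite (sum_eqr z (fun a => F [:: a])); case: (c).
rewrite E {E} /run.
by case: c; case: a0; case: a1; case: a2 => //= -[<-] [<-]; rewrite !mulr1.
Qed.

Lemma move_slide_cup i b c :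
  move_ok q X [:: Cup i b; Cross i.+1 c] [:: Cup i.+1 b; Cross i (~~ c)].
Proof.
have -> : [:: Cup i b; Cross i.+1 c] = map (shift i) [:: Cup 0 b; Cross 1 c].
  by rewrite /= addn1 addn0.
have -> : [:: Cup i.+1 b; Cross i (~~ c)] = map (shift i) [:: Cup 1 b; Cross 0 (~~ c)].
  by rewrite /= addn1 addn0.
apply: (@window_move _ _ _ 1 i) => //.
  by move=> s s1 /run_admits[_ [s' /run_admits[]]]; rewrite /admits /=; lia.
case=> [|a0 []] // s1 s2 [|x []] //= F _ _; rewrite /run /= => -[<-] [<-].
split=> //; rewrite !mulr1 !mul1r; congr (_ * _).
  by case: a0 b c => [] [] [].
rewrite !uop_cup cup0 cup1.
under eq_bigr do rewrite uop_cross capcup1.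
under [RHS]eq_bigr do rewrite uop_cross capcup0.
by case: c => /=; rewrite !sumrB -!mulr_sumr
  (sum_eqr x (fun z => \sum_a F [:: z; a; a]))
  (sum_eql x (fun z => \sum_a F [:: a; a; z])).
Qed.

Lemma move_R1_cap i c : move_ok q X [:: Cross i c; Cap i] [:: Cap i].
Proof.
have -> : [:: Cross i c; Cap i] = map (shift i) [:: Cross 0 c; Cap 0].
  by rewrite /= addn0.
have -> : [:: Cap i] = map (shift i) [:: Cap 0] by rewrite /= addn0.
apply: (@window_move _ _ _ 2 i) => //.
  by move=> s s1 /run_admits[]; rewrite /admits /=; lia.
case=> [|a0 [|a1 []]] // s1 s2 [|x [|y []]] //= F _ _; rewrite /run /=.
case: ifP => //= h1 [<-]; case: ifP => //= h2 [<-]; split=> //.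
(* The ends of a cap are oppositely oriented, so [c] alone decides the sign of the kink. The kink
   acts as -q^2 or q^-1, and [cross_norm] is the inverse. *)
rewrite (negbTE h2) uop_cross !uop_cap capcup0 cap0.
under eq_bigr do rewrite uop_cap cap0 eqxx.
rewrite sum_const; case: (x == y); case: c => /=; field.
all: by rewrite ?q_neq0.
Qed.

Lemma move_R1_cup i b c : move_ok q X [:: Cup i b; Cross i c] [:: Cup i (~~ b)].
Proof.
have -> : [:: Cup i b; Cross i c] = map (shift i) [:: Cup 0 b; Cross 0 c].
  by rewrite /= addn0.
have -> : [:: Cup i (~~ b)] = map (shift i) [:: Cup 0 (~~ b)] by rewrite /= addn0.
apply: (@window_move _ _ _ 0 i) => //.
  by move=> s s1 /run_admits[]; rewrite /admits /=; lia.
case=> // s1 s2 [] //= F _ _; rewrite /run /= => -[<-] [<-].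
split; first by case: b.
rewrite !uop_cup !cup0 !mulr1 !mul1r.
have -> : (b == ~~ b) = false by case: b.
under eq_bigr do rewrite uop_cross capcup0 eqxx.
case: c => /=; rewrite sumrB -!mulr_sumr sum_const; field.
all: by rewrite ?q_neq0.
Qed.

Lemma move_R2 i c : move_ok q X [:: Cross i c; Cross i (~~ c)] [::].
Proof.
have -> : [:: Cross i c; Cross i (~~ c)] = map (shift i) [:: Cross 0 c; Cross 0 (~~ c)].
  by rewrite /= addn0.
apply: (@window_move _ _ _ 2 i _ [::]) => //.
  by move=> s s1 /run_admits[]; rewrite /admits /=; lia.
case=> [|a0 [|a1 []]] // s1 s2 [|x [|y []]] //= F _ _; rewrite /run /= => -[<-] [<-].
(* The two crossings have opposite signs, so their norm is -q^-1; it cancels (1 - q e)(e - q) =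
   -q. *)
split=> //; rewrite mulr1 mul1r uop_cross capcup0.
under eq_bigr do rewrite uop_cross capcup0 eqxx.
rewrite uop_cross capcup0 (eq_sym a1).
case: c => /=; rewrite sumrB -!mulr_sumr sum_const;
  case: (x == y); case: (a0 == a1) => /=; field.
all: by rewrite ?q_neq0.
Qed.

Lemma move_R3 i c : move_ok q X [:: Cross i c; Cross i.+1 c; Cross i c]
                              [:: Cross i.+1 c; Cross i c; Cross i.+1 c].
Proof.
have -> : [:: Cross i c; Cross i.+1 c; Cross i c] =
    map (shift i) [:: Cross 0 c; Cross 1 c; Cross 0 c] by rewrite /= addn1 addn0.
have -> : [:: Cross i.+1 c; Cross i c; Cross i.+1 c] =
    map (shift i) [:: Cross 1 c; Cross 0 c; Cross 1 c] by rewrite /= addn1 addn0.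
apply: (@window_move _ _ _ 3 i) => //.
  by move=> s s1 /run_admits[_ [s' /run_admits[]]]; rewrite /admits /=; lia.
case=> [|a0 [|a1 [|a2 []]]] // s1 s2 [|x [|y [|z []]]] //= F _ _; rewrite /run /=.
move=> [<-] [<-]; split=> //; congr (_ * _).
  by case: a0 a1 a2 c => [] [] [] [] /=; ring.
set s := [:: x; y; z].
(* The skein relation under one and under two outer operators. Once everything is expanded and
   reduced, both sides are combinations of the same words in the two [CapCup] operators, and [field]
   compares coefficients. *)
have fop_cross f j G : fop f (uop q (Cross j c) G) s =
  if c then fop f G s - q * fop f (fop (CapCup j) G) s
  else fop f (fop (CapCup j) G) s - q * fop f G s.
  rewrite -!fopB; case: (c); apply: eq_fop_ext => t; exact: uop_cross.
have fop2_cross f f' j G : fop f (fop f' (uop q (Cross j c) G)) s =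
  if c then fop f (fop f' G) s - q * fop f (fop f' (fop (CapCup j) G)) s
  else fop f (fop f' (fop (CapCup j) G)) s - q * fop f (fop f' G) s.
  rewrite -!fopB; case: (c); apply: eq_fop_ext => t; rewrite -fopB;
    by apply: eq_fop_ext => u; rewrite uop_cross.
rewrite !uop_cross !(fop2_cross, fop_cross).
rewrite /s; case: (c); rewrite ?(capcup010, capcup101) !(capcup_idem, capcup_idem1); field.
all: by rewrite ?q_neq0.
Qed.

End LocalMoves.

Lemma shift_shift a b f : shift a (shift b f) = shift (a + b) f.
Proof. by case: f => /= *; rewrite addnA. Qed.

Lemma slice_shift f : exists f0, [/\ f = shift (pos f) f0, pos f0 = 0%N,
  bottom_ends f0 = bottom_ends f & top_ends f0 = top_ends f].
Proof.
by case: f => [i b|i|i c]; [exists (Cup 0 b)|exists (Cap 0)|exists (Cross 0 c)];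
  rewrite /= addn0.
Qed.

(** * Exchange of distant slices *)

Section Exchange.
Variables (K : fieldType) (q : K) (X : finType).

(** The slices act on disjoint blocks, so this reduces to [uop_exchange]. The gap between the blocks
    is arbitrarily long, so no window of fixed size would do. *)
Lemma move_exchange f g : (pos f <= pos g)%N ->
  move_ok q X [:: f; shift (top_ends f) g] [:: shift (bottom_ends f) g; f].
Proof.
have [f0 [Ef pf <- <-]] := slice_shift f; have [g0 [Eg pg bg tg]] := slice_shift g.
move: (pos f) (pos g) Ef Eg => i j -> -> hij {f g bg tg}.
rewrite !shift_shift => s s1 s2 ls F ra rb hls.
have hs : (j + bottom_ends f0 + bottom_ends g0 <= size s)%N.
  have [_ [s' h1 h2]] := run_admits ra; have [h3 _] := run_admits h1.
  by move: h2 h3; rewrite /admits; case: (f0) pf; case: (g0) pg => /= *; lia.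
(* Five blocks: the strands before f, the bottom ends of f, the gap, the bottom ends of g, and the
   rest. *)
have cut (T : Type) (u : seq T) : size u = size s -> exists p x t z r, [/\
    u = p ++ x ++ t ++ z ++ r, size p = i, size x = bottom_ends f0, size t = (j - i)%N
    & size z = bottom_ends g0].
  move=> hu; have [|p [u1 [E1 hp]]] := @splitat T i u; first lia.
  have [|x [u2 [E2 hx]]] := @splitat T (bottom_ends f0) u1.
    by move: hu; rewrite E1 size_cat; lia.
  have [|t [u3 [E3 ht]]] := @splitat T (j - i) u2.
    by move: hu; rewrite E1 E2 !size_cat; lia.
  have [|z [r [E4 hz]]] := @splitat T (bottom_ends g0) u3.
    by move: hu; rewrite E1 E2 E3 !size_cat; lia.
  by exists p, x, t, z, r; rewrite E1 E2 E3 E4.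
have [sp [sx [st [sz [sr [Es hsp hsx hst hsz]]]]]] := cut _ s erefl.
have [p [x [t [z [r [El hp hx ht hz]]]]]] := cut _ ls hls.
have fa : admits (bottom_ends f0) f0 by rewrite /admits pf.
have ga : admits (bottom_ends g0) g0 by rewrite /admits pg.
subst s ls.
have assoc (T : Type) (a b c d e : seq T) : a ++ b ++ c ++ d ++ e = (a ++ b ++ c) ++ d ++ e.
  by rewrite -!catA.
have szg (T : Type) (a b c : seq T) k : size a = i -> size b = k -> size c = (j - i)%N ->
    (k + j)%N = size (a ++ b ++ c).
  by rewrite !size_cat; lia.
have [yf hyf] : exists y, act f0 sx = Some y.
  have := ra; rewrite run_cons -{1}hsp act_shift ?hsx //.
  by case: (act f0 sx) => // y _; exists y.
have [yg hyg] : exists y, act g0 sz = Some y.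
  have := rb; rewrite run_cons assoc (szg _ sp sx st) // act_shift ?hsz //.
  by case: (act g0 sz) => // y _; exists y.
have hyfs : size yf = top_ends f0 by have [_] := size_act hyf; lia.
have hygs : size yg = top_ends g0 by have [_] := size_act hyg; lia.
have a1 : act (shift i f0) (sp ++ sx ++ st ++ sz ++ sr) = Some (sp ++ yf ++ st ++ sz ++ sr).
  by rewrite -{1}hsp act_shift ?hsx // hyf.
have a2 : act (shift (bottom_ends f0 + j) g0) (sp ++ sx ++ st ++ sz ++ sr) =
    Some (sp ++ sx ++ st ++ yg ++ sr).
  by rewrite assoc (szg _ sp sx st) // act_shift ?hsz // hyg /= -!catA.
have a3 : act (shift (top_ends f0 + j) g0) (sp ++ yf ++ st ++ sz ++ sr) =
    Some (sp ++ yf ++ st ++ yg ++ sr).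
  by rewrite assoc (szg _ sp yf st) // act_shift ?hsz // hyg /= -!catA.
have a4 : act (shift i f0) (sp ++ sx ++ st ++ yg ++ sr) =
    Some (sp ++ yf ++ st ++ yg ++ sr).
  by rewrite -{1}hsp act_shift ?hsx // hyf.
split.
  move: ra rb; rewrite !run_cons a1 /= !run_cons a3 a2 /= run_cons a4 /=.
  by rewrite /run /= => -[<-] [<-].
have n1 : norm q (sp ++ sx ++ st ++ sz ++ sr) [:: shift i f0; shift (top_ends f0 + j) g0] =
    cross_norm q sx f0 * cross_norm q sz g0.
  rewrite /= a1 /= mulr1 -{1}hsp cross_norm_shift ?hsx //; congr (_ * _).
  by rewrite assoc (szg _ sp yf st) // cross_norm_shift ?hsz.
have n2 : norm q (sp ++ sx ++ st ++ sz ++ sr)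
      [:: shift (bottom_ends f0 + j) g0; shift i f0] =
    cross_norm q sz g0 * cross_norm q sx f0.
  rewrite /= a2 /= mulr1 -{1}hsp cross_norm_shift ?hsx //; congr (_ * _).
  by rewrite assoc (szg _ sp sx st) // cross_norm_shift ?hsz.
rewrite n1 n2 (mulrC (cross_norm q sz g0)); congr (_ * _).
rewrite [LHS]/= [RHS]/=.
transitivity (uop q f0 (fun y => uop q g0 (fun w => F (p ++ y ++ t ++ w ++ r)) z) x).
  rewrite -{1}hp uop_shift ?hx //; apply: (eq_uop q hyf); first by rewrite hx hsx.
  move=> y hy; rewrite assoc (szg _ p y t) ?hy // uop_shift ?hz //.
  by apply: eq_bigr => b _; congr (_ * _); apply: eq_bigr => w _; rewrite -assoc.
rewrite uop_exchange assoc (szg _ p x t) // uop_shift ?hz //.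
apply: (eq_uop q hyg); first by rewrite hz hsz.
by move=> w hw; rewrite -assoc -{1}hp uop_shift ?hx.
Qed.

End Exchange.

Lemma uops_mulr (K : fieldType) (q : K) (X : finType) w (c : K) (F : seq X -> K) s :
  uops q w (fun r => c * F r) s = c * uops q w F s.
Proof.
rewrite !uops_masks mulr_sumr; apply: eq_bigr => bs _; rewrite mulrCA; congr (_ * _).
by rewrite -(fops_additive (h := fun a => c * a)) ?mulr0 // => a b; rewrite mulrDr.
Qed.

Section Isotopy.
Variables (K : fieldType) (q : K) (X : finType).
Hypothesis q_neq0 : q != 0.
Hypothesis card_X : #|X|%:R = q + q^-1.
Variable x0 : X.

Lemma local_move_ok a b : local_move a b -> move_ok q X a b.
Proof.
case=> [f g|i o|i o|i c|i o c|i c|i o c|i c|i c].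
- exact: move_exchange.
- exact: move_zigzag_l.
- exact: move_zigzag_r.
- exact: move_slide_cap.
- exact: move_slide_cup.
- exact: move_R1_cap.
- exact: move_R1_cup.
- exact: move_R2.
exact: move_R3.
Qed.

Lemma move_invariant (g : X -> X) (D D' : diagram) u v a b : local_move a b ->
    base D = base D' -> word D = u ++ a ++ v -> word D' = u ++ b ++ v ->
  norm q (base D) (word D) * utrace q g (size (base D)) (word D) =
  norm q (base D') (word D') * utrace q g (size (base D')) (word D').
Proof.
move=> hab Eb Ew Ew'; have := run_word D'; have := run_word D; rewrite Ew Ew' -Eb.
set s := base D; rewrite !run_cat; case Eu : (run s u) => [s0|] //=.
rewrite !run_cat; case Ea : (run s0 a) => [s1|] //=; case Eb' : (run s0 b) => [s2|] //=.
move=> hv _; have hmv := local_move_ok hab.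
(* [move_ok] yields equality of the final orientations only for a given label word; a constant one
   is built from [x0]. *)
have [E _] := hmv s0 s1 s2 (nseq (size s0) x0) (fun=> 0) Ea Eb' (size_nseq _ _).
rewrite (norm_cat q (a ++ v) Eu) (norm_cat q (b ++ v) Eu).
rewrite (norm_cat q v Ea) (norm_cat q v Eb') -E.
rewrite -!mulrA; congr (_ * _); rewrite mulrCA [RHS]mulrCA; congr (_ * _).
rewrite /utrace !mulr_sumr; apply: eq_bigr => t _; rewrite !uops_cat.
rewrite -!uops_mulr; apply: (eq_uops q Eu); rewrite ?size_tuple // => y hy /=.
by have [] := hmv s0 s1 s2 y (uops q v (fun r => (r == map g t)%:R)) Ea Eb' hy.
Qed.

End Isotopy.

(** * Laurent polynomials uniform in the field *)

(** One integer Laurent polynomial computes the formula in every field; this is the bridge from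
    [algC], where the special values of q live, to [Zq]. *)
Definition laurent_family (f : forall K : fieldType, K -> K) : Prop :=
  exists (p : {poly int}) (n : nat), forall (K : fieldType) (q : K), q != 0 ->
    f K q = (map_poly intr p).[q] / q ^+ n.

Lemma laurent_const (c : int) : laurent_family (fun K _ => c%:~R).
Proof.
by exists c%:P, 0%N => K q _; rewrite map_polyC hornerC divr1.
Qed.

Lemma laurent_q : laurent_family (fun K q => q).
Proof. by exists 'X, 0%N => K q _; rewrite map_polyX hornerX divr1. Qed.

Lemma laurent_qV : laurent_family (fun K q => q^-1).
Proof. by exists 1, 1%N => K q _; rewrite rmorph1 hornerC mul1r expr1. Qed.

Lemma laurentD f g : laurent_family f -> laurent_family g ->
  laurent_family (fun K q => f K q + g K q).
Proof.
move=> [p [n hf]] [r [k hg]].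
exists (p * 'X^k + r * 'X^n), (n + k)%N => K q q0.
rewrite hf // hg // rmorphD !rmorphM /= !map_polyXn hornerD !hornerM !hornerXn exprD.
by field; rewrite !expf_neq0.
Qed.

Lemma laurentM f g : laurent_family f -> laurent_family g ->
  laurent_family (fun K q => f K q * g K q).
Proof.
move=> [p [n hf]] [r [k hg]]; exists (p * r), (n + k)%N => K q q0.
rewrite hf // hg // rmorphM /= hornerM exprD.
by field; rewrite !expf_neq0.
Qed.

Lemma laurentN f : laurent_family f -> laurent_family (fun K q => - f K q).
Proof.
by move=> [p [n hf]]; exists (- p), n => K q q0; rewrite hf // rmorphN hornerN mulNr.
Qed.

Lemma laurentX f n : laurent_family f -> laurent_family (fun K q => f K q ^+ n).
Proof.
move=> hf; elim: n => [|n IHn]; first exact: (laurent_const 1).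
have [p [k h]] := laurentM hf IHn; exists p, k => K q q0.
by rewrite exprS h.
Qed.

Lemma laurent_sum (I : Type) (r : seq I) (P : pred I)
    (f : I -> forall K : fieldType, K -> K) :
  (forall i, laurent_family (f i)) ->
  laurent_family (fun K q => \sum_(i <- r | P i) f i K q).
Proof.
move=> hf; elim: r => [|i r IHr].
  have [p [k h]] := laurent_const 0; exists p, k => K q q0.
  by rewrite big_nil -(h K q).
have [p [k h]] := laurentD (hf i) IHr; have [p' [k' h']] := IHr.
have [Pi|Pi] := boolP (P i).
  by exists p, k => K q q0; rewrite big_cons Pi h.
by exists p', k' => K q q0; rewrite big_cons (negbTE Pi) h'.
Qed.

Lemma laurent_cross_norm s f : laurent_family (fun K q => cross_norm q s f).
Proof.
case: f => [i b|i|i c] /=; try exact: (laurent_const 1).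
case: eqP => _; first exact: laurent_q.
have [p [k h]] := laurentN (laurentX 2 laurent_qV).
by exists p, k => K q q0; rewrite -h // exprVn.
Qed.

Lemma laurent_norm s w : laurent_family (fun K q => norm q s w).
Proof.
elim: w s => [|f w IHw] s; first exact: (laurent_const 1).
exact: laurentM (laurent_cross_norm s f) (IHw _).
Qed.

Lemma laurent_state_sum D : laurent_family (fun K q => state_sum q D).
Proof.
apply: (laurentM (laurent_norm (base D) (word D))).
apply: (@laurent_sum (vertex D) (index_enum (vertex D))
  (fun al => al \subset crossings D) (fun (al : vertex D) K q => (- q) ^+ #|al| *
  (if trivial_state al then (q + q^-1) ^+ #|circles al| else 0))) => al.
apply: (laurentM (laurentX #|al| (laurentN laurent_q))).
case: (trivial_state al); last exact: (laurent_const 0).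
exact: (laurentX _ (laurentD laurent_q laurent_qV)).
Qed.

Lemma exists_qN (n : nat) : exists q : algC, q + q^-1 = n.+2%:R.
Proof.
(* q is a root of X^2 - z X + 1, and the conjugate root is its inverse. *)
pose z : algC := n.+2%:R; pose d := sqrtC (z ^+ 2 - 4%:R).
have hd : d ^+ 2 = z ^+ 2 - 4%:R by apply: sqrtCK.
exists ((z + d) / 2%:R).
have two0 : (2%:R : algC) != 0 by rewrite pnatr_eq0.
have h : (z + d) / 2%:R * ((z - d) / 2%:R) = 1.
  rewrite mulf_div [(z + d) * _]mulrC -subr_sqr hd opprB addrC subrK -natrM divff //.
  by rewrite pnatr_eq0.
have h0 : (z + d) / 2%:R != 0.
  by apply/eqP=> E; move: h; rewrite E mul0r => /eqP; rewrite eq_sym oner_eq0.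
have -> : ((z + d) / 2%:R)^-1 = (z - d) / 2%:R.
  by apply: (mulfI h0); rewrite h mulfV.
by rewrite -mulrDl addrACA subrr addr0 -mulr2n -[z *+ 2]mulr_natr mulfK.
Qed.

(** Clearing denominators turns the difference into an integer polynomial [u]. The solutions [qN j]
    of q + q^-1 = j + 2 with j at least [n0] are infinitely many distinct roots of it, so [u] is 0,
    and this holds in every field. *)
Lemma laurent_family_eq f g (n0 : nat) : laurent_family f -> laurent_family g ->
    (forall n (q : algC), (n0 <= n)%N -> q + q^-1 = n.+2%:R -> f algC q = g algC q) ->
  forall (K : fieldType) (q : K), q != 0 -> f K q = g K q.
Proof.
move=> [p [n hf]] [r [k hg]] hfg.
pose u := p * 'X^k - r * 'X^n.
have uE (K : fieldType) (q : K) : q != 0 ->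
    (map_poly intr u).[q] = (f K q - g K q) * q ^+ (n + k).
  move=> q0; rewrite hf // hg // rmorphB !rmorphM /= !map_polyXn hornerD hornerN.
  rewrite !hornerM !hornerXn exprD; field.
  by rewrite !expf_neq0.
suff u0 : u = 0.
  move=> K q q0; have := uE K q q0; rewrite u0 rmorph0 horner0 => /esym/eqP.
  by rewrite mulf_eq0 expf_eq0 (negbTE q0) andbF orbF subr_eq0 => /eqP.
have ex j : exists q : algC, q + q^-1 == j.+2%:R.
  by have [q hq] := exists_qN j; exists q; apply/eqP.
pose qN j : algC := xchoose (ex j).
have qNE j : qN j + (qN j)^-1 = j.+2%:R by apply/eqP/(xchooseP (ex j)).
have qN0 j : qN j != 0.
  apply/eqP=> E; have := qNE j; rewrite E invr0 addr0 => /esym/eqP.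
  by rewrite pnatr_eq0.
have qN_inj : injective qN.
  move=> i j E; have := qNE j; rewrite -E qNE => /eqP.
  by rewrite eqr_nat => /eqP[].
have intr_inj : injective (intr : int -> algC) by apply: intr_inj.
apply: (map_inj_poly intr_inj (rmorph0 _)); rewrite rmorph0.
apply/eqP; apply: contraT => nz.
have := max_poly_roots
  (rs := [seq qN j | j <- iota n0 (size (map_poly (intr : int -> algC) u))]) nz.
rewrite size_map size_iota ltnn => -> //.
  apply/allP=> x /mapP[j]; rewrite mem_iota => /andP[hj _] ->.
  by apply/rootP; rewrite uE // (hfg j) ?subrr ?mul0r ?qNE.
by rewrite map_inj_uniq ?iota_uniq.
Qed.

Lemma state_sum_step (D D' : diagram) :
    (forall n (q : algC), (#|point D| + #|point D'| <= n)%N -> q + q^-1 = n.+2%:R ->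
       state_sum q D = state_sum q D') ->
  forall (K : fieldType) (q : K), q != 0 -> state_sum q D = state_sum q D'.
Proof.
exact: (laurent_family_eq (laurent_state_sum D) (laurent_state_sum D')).
Qed.

Lemma qV_neq0 (K : numFieldType) n (q : K) : q + q^-1 = n.+2%:R -> q != 0.
Proof.
move=> E; apply/eqP=> E0; move: E; rewrite E0 invr0 addr0 => /esym/eqP.
by rewrite pnatr_eq0.
Qed.

(** How large N must be depends on the diagrams. Each elementary move is therefore settled in [algC]
    for its own large N and returned to all fields before moves are chained. *)
Theorem state_sum_isotopic (D D' : diagram) : isotopic D D' ->
  forall (K : fieldType) (q : K), q != 0 -> state_sum q D = state_sum q D'.
Proof.
move=> h; elim: D D' / h => [D|D D' _ IH|D D' D'' _ IH1 _ IH2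
  |D D' u v a b hab Eb Ew Ew'|D D' u v hu Ew Ew'].
- by [].
- by move=> K q q0; rewrite IH.
- by move=> K q q0; rewrite IH1 ?IH2.
- apply: state_sum_step => n q hn hq.
  rewrite !(state_sum_utrace _ hq); try lia.
  apply: move_invariant hab Eb Ew Ew' => //; first exact: qV_neq0 hq.
    by rewrite card_ord.
  exact: ord0.
apply: state_sum_step => n q hn hq.
rewrite !(state_sum_utrace _ hq); try lia.
have hv : run (base D') v = Some (base D).
  by have := run_word D; rewrite Ew run_cat hu.
rewrite Ew Ew' (norm_cat q v hu) (norm_cat q u hv) mulrC [in RHS](mulrC (norm _ _ _)).
rewrite (utrace_rot q (@succZ_inj n) hu hv) mulrC; congr (_ * _).
Qed.

(** * Double coverings modulo 2 *)

Definition loops (D : diagram) (al : vertex D) : option nat :=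
  if trivial_state al then Some #|circles al| else None.

Definition loop_value (R : pzSemiRingType) (c : R) (o : option nat) : R :=
  if o is Some k then c ^+ k else 0.

(** Powers of a base at least 2 are nonzero and distinct. Hence a single count of labelings reveals
    whether all circles are trivial and, if so, how many there are. *)
Lemma loop_value_inj N : injective (loop_value (R := nat) N.+2).
Proof.
move=> [c|] [c'|] //= /eqP.
- by rewrite eqn_exp2l // => /eqP->.
- by rewrite expn_eq0.
by rewrite eq_sym expn_eq0.
Qed.

Section Lift.
Variable D : diagram.
Notation w := (word D).
Notation L := (Defs.lift D).

Lemma flats_lift b1 b2 : size b1 = size w -> size b2 = size w ->
  flats (mask_state L (b1 ++ b2)) = flatw w b1 ++ flatw w b2.
Proof.
by move=> h1 h2; rewrite flats_mask /= ?size_cat ?h1 ?h2 // flatw_cat.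
Qed.

Lemma fcount_loops (D' : diagram) (al : vertex D') N : (#|point D'| < N.+2)%N ->
  fcount (@succZ N) (size (base D')) (flats al) = loop_value N.+2 (loops al).
Proof. by move=> hN; rewrite fcount_succZ // /loops; case: ifP. Qed.

(** The rotation of the covering takes the form of cyclicity of the trace, so no map between circles
    has to be built. *)
Lemma loops_lift_sym b1 b2 : size b1 = size w -> size b2 = size w ->
  loops (mask_state L (b1 ++ b2)) = loops (mask_state L (b2 ++ b1)).
Proof.
move=> h1 h2; apply: (@loop_value_inj #|point L|).
rewrite -!fcount_loops ?flats_lift //; try lia.
have f1 := fitsw_flatw (run_word D) h1; have f2 := fitsw_flatw (run_word D) h2.
by rewrite [base L]/=; move: (#|point L|) => N; apply: (fcount_rot (@succZ_inj N) f1 f2).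
Qed.

Lemma loops_lift_diag b : size b = size w ->
  loops (mask_state L (b ++ b)) = omap (muln 2) (loops (mask_state D b)).
Proof.
(* N must be large for both diagrams: the same count is read as cyclic labelings of the covering and
   as pair labelings of the quotient. *)
move=> hb; set N := (#|point L| + #|point D|)%N; apply: (@loop_value_inj N).
rewrite -fcount_loops ?flats_lift //; last by rewrite /N; lia.
rewrite -(fcount_pair _ (fitsw_flatw (run_word D) hb)) -flats_mask //.
rewrite (fcount_swapZ (mask_state D b) (N := N)); last by rewrite /N; lia.
by rewrite /loops; case: ifP.
Qed.

End Lift.

(** * Congruence of Laurent polynomials modulo 2 *)

Section LaurentMod2.

Lemma qvar_neq0 : qvar != 0.
Proof. by rewrite tofrac_eq0 polyX_eq0. Qed.

Lemma is_laurentD f g : is_laurent f -> is_laurent g -> is_laurent (f + g).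
Proof.
move=> [p [n ->]] [r [k ->]]; exists (p * 'X^k + r * 'X^n), (n + k)%N.
rewrite rmorphD !rmorphM !rmorphXn -/qvar exprD.
by rewrite addf_div ?expf_neq0 ?qvar_neq0.
Qed.

Lemma is_laurentM f g : is_laurent f -> is_laurent g -> is_laurent (f * g).
Proof.
move=> [p [n ->]] [r [k ->]]; exists (p * r), (n + k)%N.
by rewrite rmorphM exprD mulf_div.
Qed.

Lemma is_laurent_int (c : int) : is_laurent c%:~R.
Proof. by exists c%:~R, 0%N; rewrite rmorph_int divr1. Qed.

Lemma is_laurentN f : is_laurent f -> is_laurent (- f).
Proof. by move=> h; rewrite -mulN1r; apply: is_laurentM h; apply: (is_laurent_int (-1)). Qed.

Lemma is_laurent_sum (I : Type) (r : seq I) (P : pred I) F :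
  (forall i, is_laurent (F i)) -> is_laurent (\sum_(i <- r | P i) F i).
Proof.
move=> hF; elim/big_rec: _ => [|i x _]; first exact: (is_laurent_int 0).
exact: is_laurentD.
Qed.

Lemma is_laurentX f n : is_laurent f -> is_laurent (f ^+ n).
Proof.
move=> hf; elim: n => [|n IHn]; first exact: (is_laurent_int 1).
by rewrite exprS; apply: is_laurentM.
Qed.

Lemma is_laurent_q : is_laurent qvar.
Proof. by exists 'X, 0%N; rewrite divr1. Qed.

Lemma is_laurent_qV : is_laurent qvar^-1.
Proof. by exists 1, 1%N; rewrite rmorph1 mul1r. Qed.

Lemma eqmod2_refl f : laurent_eqmod2 f f.
Proof. by exists 0; [exact: (is_laurent_int 0)|rewrite subrr mulr0]. Qed.

Lemma eqmod2_sym f g : laurent_eqmod2 f g -> laurent_eqmod2 g f.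
Proof. by case=> h hh E; exists (- h); [exact: is_laurentN|rewrite mulrN -E opprB]. Qed.

Lemma eqmod2_trans f g h : laurent_eqmod2 f g -> laurent_eqmod2 g h -> laurent_eqmod2 f h.
Proof.
move=> [a ha Ea] [b hb Eb]; exists (a + b); first exact: is_laurentD.
by rewrite mulrDr -Ea -Eb addrA subrK.
Qed.

Lemma eqmod2D f f' g g' : laurent_eqmod2 f f' -> laurent_eqmod2 g g' ->
  laurent_eqmod2 (f + g) (f' + g').
Proof.
move=> [a ha Ea] [b hb Eb]; exists (a + b); first exact: is_laurentD.
by rewrite mulrDr -Ea -Eb opprD addrACA.
Qed.

Lemma eqmod2_sum (I : Type) (r : seq I) (P : pred I) F G :
  (forall i, P i -> laurent_eqmod2 (F i) (G i)) ->
  laurent_eqmod2 (\sum_(i <- r | P i) F i) (\sum_(i <- r | P i) G i).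
Proof.
move=> h; elim/big_rec2: _ => [|i x y /h hi]; first exact: eqmod2_refl.
exact: eqmod2D.
Qed.

Lemma eqmod2Ml c f g : is_laurent c -> laurent_eqmod2 f g ->
  laurent_eqmod2 (c * f) (c * g).
Proof.
move=> hc [h hh E]; exists (c * h); first exact: is_laurentM.
by rewrite -mulrBr E mulrCA.
Qed.

Lemma eqmod2N f : is_laurent f -> laurent_eqmod2 (- f) f.
Proof.
move=> hf; exists (- f); first exact: is_laurentN.
by rewrite mulrN mulr_natl mulr2n opprD.
Qed.

Lemma eqmod2_0 f : is_laurent f -> laurent_eqmod2 (2%:R * f) 0.
Proof. by move=> hf; exists f; rewrite ?subr0. Qed.

(** Terms off the diagonal come in equal pairs. This serves both for the resolutions of the covering
    and for the square of a sum. *)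
Lemma sum_symm_eqmod2 (I : eqType) (r : seq I) (t : I -> I -> Zq) :
    (forall i j, is_laurent (t i j)) ->
    {in r &, forall i j, t i j = t j i} ->
  laurent_eqmod2 (\sum_(i <- r) \sum_(j <- r) t i j) (\sum_(i <- r) t i i).
Proof.
move=> hl; elim: r => [|a r IHr] ht; first by rewrite !big_nil; apply: eqmod2_refl.
rewrite !big_cons; under [X in _ + X]eq_bigr do rewrite big_cons.
rewrite big_split /= -addrA.
have -> : \sum_(j <- r) t j a = \sum_(j <- r) t a j.
  by apply: eq_big_seq => j hj; apply: ht; rewrite !inE ?hj ?eqxx ?orbT.
apply: eqmod2D; first exact: eqmod2_refl.
rewrite addrA -[X in laurent_eqmod2 _ X]add0r; apply: eqmod2D.
  rewrite -mulr2n -mulr_natl; apply/eqmod2_0/is_laurent_sum => j; exact: hl.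
by apply: IHr => i j hi hj; apply: ht; rewrite inE ?hi ?hj orbT.
Qed.

Lemma laurent_family_qvar f : laurent_family f -> is_laurent (f Zq qvar).
Proof.
case=> p [n hf]; exists p, n; rewrite hf ?qvar_neq0 //; congr (_ / _).
elim/poly_ind: p {hf} => [|p c IHp]; first by rewrite !rmorph0 horner0.
rewrite !rmorphD !rmorphM /= map_polyX map_polyC hornerMXaddC IHp; congr (_ + _).
by rewrite -[c in RHS]intz !rmorph_int.
Qed.

Lemma is_laurent_norm s w : is_laurent (norm qvar s w).
Proof. exact: laurent_family_qvar (laurent_norm s w). Qed.

Lemma is_laurent_state_sum D : is_laurent (state_sum qvar D).
Proof. exact: laurent_family_qvar (laurent_state_sum D). Qed.

Lemma is_laurent_loop_value o : is_laurent (loop_value (qvar + qvar^-1) o).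
Proof.
case: o => [k|] /=; last exact: (is_laurent_int 0).
exact/is_laurentX/is_laurentD/is_laurent_qV/is_laurent_q.
Qed.

Lemma state_sum_masks (K : fieldType) (q : K) D :
  state_sum q D = norm q (base D) (word D) * \sum_(bs <- masks (word D))
    (- q) ^+ count id bs * loop_value (q + q^-1) (loops (mask_state D bs)).
Proof.
rewrite /state_sum sum_states; congr (_ * _); rewrite !big_seq.
apply: eq_bigr => bs /size_masks hs; rewrite card_mask //; congr (_ * _).
by rewrite /loops; case: ifP.
Qed.

Lemma state_sum_lift D :
  laurent_eqmod2 (state_sum qvar (Defs.lift D)) (state_sum qvar D ^+ 2).
Proof.
rewrite !state_sum_masks exprMn /= (norm_cat qvar _ (run_word D)) -expr2.
apply: eqmod2Ml; first exact/is_laurentX/is_laurent_norm.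
pose t' b := (- qvar) ^+ count id b *
  loop_value (qvar + qvar^-1) (loops (mask_state D b)).
rewrite big_masks_cat -[X in X ^+ 2]/(\sum_(b <- masks (word D)) t' b).
pose t b1 b2 := (- qvar) ^+ (count id b1 + count id b2) *
  loop_value (qvar + qvar^-1) (loops (mask_state (Defs.lift D) (b1 ++ b2))).
have ht b1 b2 : is_laurent (t b1 b2).
  by apply: is_laurentM (is_laurent_loop_value _); apply/is_laurentX/is_laurentN/is_laurent_q.
have ht' b : is_laurent (t' b).
  by apply: is_laurentM (is_laurent_loop_value _); apply/is_laurentX/is_laurentN/is_laurent_q.
have -> : \sum_(b1 <- masks (word D)) \sum_(b2 <- masks (word D))
    (- qvar) ^+ count id (b1 ++ b2) *
    loop_value (qvar + qvar^-1) (loops (mask_state (Defs.lift D) (b1 ++ b2))) =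
    \sum_(b1 <- masks (word D)) \sum_(b2 <- masks (word D)) t b1 b2.
  by do 2 (apply: eq_bigr => ? _); rewrite /t count_cat.
apply: eqmod2_trans (sum_symm_eqmod2 ht _) _.
  move=> b1 b2 /size_masks h1 /size_masks h2; rewrite /t addnC.
  by rewrite loops_lift_sym.
have -> : \sum_(b <- masks (word D)) t b b = \sum_(b <- masks (word D)) t' b * t' b.
  rewrite !big_seq; apply: eq_bigr => b /size_masks hb.
  rewrite /t /t' loops_lift_diag // exprD mulrACA; congr (_ * _).
  by case: (loops _) => [k|] /=; rewrite ?mulr0 // mul2n -addnn exprD.
rewrite expr2 big_distrl /=.
under [X in laurent_eqmod2 _ X]eq_bigr do rewrite big_distrr.
(* The same symmetry read backwards, from the sum of the squares to the square of the sum. *)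
apply/eqmod2_sym/sum_symm_eqmod2 => [i j|i j _ _]; first exact: is_laurentM.
exact: mulrC.
Qed.

End LaurentMod2.

(** * The Euler characteristic of the annular complex *)

Section EulerCharacteristic.
Variable D : diagram.

Let up (d : int * int * int) := let: (i, j, k) := d in (i + 1, j, k).
Let dn (d : int * int * int) := let: (i, j, k) := d in (i - 1, j, k).
Let wt (d : int * int * int) : Zq := qvar ^ (d.1.2 - d.2).
Let rk (d e : int * int * int) : nat := \rank (diff D d e).

Let upK : cancel up dn. Proof. by move=> [[i j] k]; rewrite /= addrK. Qed.
Let dnK : cancel dn up. Proof. by move=> [[i j] k]; rewrite /= subrK. Qed.
Let wt_dn d : wt (dn d) = wt d. Proof. by case: d => [[i j] k]. Qed.

Lemma AKh_polyE : AKh_poly D 1 qvar qvar^-1 =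
  \sum_(d <- undup [seq degree g | g in generators D])
     wt d * ((#|gens_of D d|)%:R - (rk d (up d))%:R - (rk (dn d) d)%:R).
Proof.
rewrite /AKh_poly; apply: eq_bigr => -[[i j] k] _.
rewrite exp1rz mul1r exprz_inv -expfzDr ?qvar_neq0 //; congr (_ * _).
rewrite /AKh_rank mxrank_ker /rk /= rmorphB /= -subzn ?rank_leq_row //.
by rewrite rmorphB.
Qed.

(** Both sums list the same differentials, by source and by target, and the weight does not see the
    shift of i. A differential whose source or target degree is outside S has an empty matrix and
    rank 0. *)
Lemma sum_rank : let S := undup [seq degree g | g in generators D] in
  \sum_(d <- S) wt d * (rk d (up d))%:R = \sum_(d <- S) wt d * (rk (dn d) d)%:R.
Proof.
move=> S; have S_uniq : uniq S by apply: undup_uniq.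
have gens0 d : d \notin S -> #|gens_of D d| = 0%N.
  move=> hd; apply/eqP; rewrite cards_eq0; apply/eqP/setP=> g; rewrite in_set in_set0.
  apply/negP=> /andP[hg /eqP Ed]; case/negP: hd.
  by rewrite mem_undup -Ed; apply: map_f; rewrite mem_enum.
have rk0l d e : d \notin S -> rk d e = 0%N.
  by move/gens0 => h; apply/eqP; rewrite -leqn0;
    apply: leq_trans (rank_leq_row _) _; rewrite h.
have rk0r d e : e \notin S -> rk d e = 0%N.
  by move/gens0 => h; apply/eqP; rewrite -leqn0;
    apply: leq_trans (rank_leq_col _) _; rewrite h.
rewrite (bigID (fun d => up d \in S)) /= [X in _ + X]big1 ?addr0; last first.
  by move=> d hd; rewrite rk0r ?mulr0.
rewrite [RHS](bigID (fun d => dn d \in S)) /= [X in _ = _ + X]big1 ?addr0; last first.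
  by move=> d hd; rewrite rk0l ?mulr0.
rewrite -big_filter -[RHS]big_filter.
transitivity (\sum_(e <- [seq up d | d <- S & up d \in S]) wt e * (rk (dn e) e)%:R).
  by rewrite big_map; apply: eq_bigr => d _; rewrite upK -(wt_dn (up d)) upK.
apply: perm_big; apply: uniq_perm.
- by rewrite map_inj_uniq ?filter_uniq //; apply: can_inj upK.
- exact: filter_uniq.
move=> e; rewrite mem_filter; apply/mapP/andP => [[d]|[h1 h2]].
  by rewrite mem_filter => /andP[h1 h2] ->; rewrite upK.
by exists (dn e); rewrite ?dnK // mem_filter dnK h2.
Qed.

Lemma sum_gens : let S := undup [seq degree g | g in generators D] in
  \sum_(d <- S) wt d * (#|gens_of D d|)%:R = \sum_(g in generators D) wt (degree g).
Proof.
move=> S; have S_uniq : uniq S by apply: undup_uniq.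
transitivity (\sum_(d <- S) \sum_(g in generators D | degree g == d) wt (degree g)).
  apply: eq_bigr => d _; rewrite -sum1_card natr_sum mulr_sumr.
  by apply: eq_big => [g|g]; rewrite ?inE // => /andP[_ /eqP->]; rewrite mulr1.
rewrite (exchange_big_dep (mem (generators D))) /=; last by move=> d g _ /andP[].
apply: eq_bigr => g hg; rewrite hg /=.
rewrite (eq_bigl (pred1 (degree g))); last by move=> d; rewrite /= eq_sym.
rewrite -big_filter filter_pred1_uniq ?big_seq1 // mem_undup.
by apply: map_f; rewrite mem_enum.
Qed.

Lemma is_laurent_exp (n : int) : is_laurent (qvar ^ n).
Proof.
case: n => n; first exact/is_laurentX/is_laurent_q.
by rewrite NegzE -exprz_inv; apply/is_laurentX/is_laurent_qV.
Qed.

Lemma AKh_poly_gens : laurent_eqmod2 (AKh_poly D 1 qvar qvar^-1)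
  (\sum_(g in generators D) qvar ^ (gr_j g - gr_k g)).
Proof.
rewrite AKh_polyE; under eq_bigr do rewrite !mulrBr.
rewrite !sumrB -sum_rank sum_gens.
rewrite -[X in laurent_eqmod2 _ X]/(\sum_(g in generators D) wt (degree g)).
set A := \sum_(g in _) _; set B := \sum_(d <- _) _.
have hB : is_laurent B.
  apply: is_laurent_sum => d; apply: is_laurentM; first exact: is_laurent_exp.
  exact: (is_laurent_int (rk d (up d))).
exists (- B); first exact: is_laurentN.
by rewrite mulrN mulr_natl mulr2n opprD -!addrA addrC !addrA addrNK addrC.
Qed.

End EulerCharacteristic.

(** * Generators as labelings of circles *)

Section GeneratorSum.
Variable D : diagram.
Notation m := (size (word D)).

Lemma circlesP (al : vertex D) (C : {set point D}) x :
  C \in circles al -> x \in C -> C = circle al x.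
Proof. by case/imsetP=> y _ -> h; rewrite (circle_eq h). Qed.

Lemma circle_in (al : vertex D) x : circle al x \in circles al.
Proof. exact: imset_f. Qed.

Lemma trivial_stateE (al : vertex D) :
  trivial_state al = [forall C in circles al, ~~ nontrivial al C].
Proof.
apply/forallP/forall_inP => [h C /imsetP[x _ ->]|h x].
  by apply/exists_inP=> -[y _]; rewrite h.
have := h _ (circle_in al x); rewrite negb_exists => /forallP/(_ x).
by rewrite mem_circle /= negbK.
Qed.

(** Each point lies on exactly one circle, so a compatible set of points is the union of the circles
    it contains. *)
Lemma sum_labelings (al : vertex D) (F : {set point D} -> Zq) :
  \sum_(P : {set point D} | [forall C in circles al, (C \subset P) || [disjoint C & P]])
     F P =
  \sum_(J : {set {set point D}} | J \subset circles al) F (cover J).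
Proof.
have coverK (J : {set {set point D}}) : J \subset circles al ->
    [set C in circles al | C \subset cover J] = J.
  move/subsetP=> hJ; apply/setP=> C; rewrite inE; apply/andP/idP => [[hC hCJ]|hC].
    have /imsetP[x _ EC] := hC.
    have : x \in cover J by apply: (subsetP hCJ); rewrite EC mem_circle.
    case/bigcupP=> C' hC' hx; rewrite EC -(circlesP _ hx) //.
    exact: hJ.
  by split; [exact: hJ|apply: bigcup_sup].
rewrite (reindex_onto (fun J : {set {set point D}} => cover J)
  (fun P => [set C in circles al | C \subset P])) /=.
  apply: eq_bigl => J; apply/andP/idP => [[_ /eqP <-]|hJ].
    by apply/subsetP=> C; rewrite inE => /andP[].
  split; last by rewrite coverK.
  apply/forall_inP=> C hC; have [hCJ|hCJ] := boolP (C \in J).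
    by apply/orP; left; apply: bigcup_sup.
  apply/orP; right; rewrite disjoints_subset; apply/subsetP=> x hx.
  rewrite inE; apply/negP=> /bigcupP[C' hC' hx']; case/negP: hCJ.
  by rewrite (circlesP hC hx) -(circlesP _ hx') // (subsetP hJ).
move=> P /forall_inP hP; apply/setP=> x; apply/bigcupP/idP => [[C]|hx].
  by rewrite inE => /andP[_ /subsetP hC] /hC.
exists (circle al x); last exact: mem_circle.
rewrite inE circle_in; case/orP: (hP _ (circle_in al x)) => //.
by rewrite disjoint_sym => /disjointFr/(_ hx); rewrite mem_circle.
Qed.

Lemma cover_plus (al : vertex D) (J : {set {set point D}}) C :
  J \subset circles al -> C \in circles al -> plus (al, cover J) C = (C \in J).
Proof.
move=> hJ hC; rewrite /plus /=; apply/idP/idP => [h|h]; last exact: bigcup_sup.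
have /imsetP[x _ EC] := hC.
have : x \in cover J by apply: (subsetP h); rewrite EC mem_circle.
case/bigcupP=> C' hC' hx; rewrite EC -(circlesP _ hx) //.
exact: (subsetP hJ).
Qed.

Let weight (al : vertex D) (C : {set point D}) (b : bool) : Zq :=
  if nontrivial al C then 1 else if b then qvar else qvar^-1.

(** The label of a nontrivial circle enters [gr_j] and [gr_k] equally and cancels in the difference;
    that of a trivial circle enters [gr_j] alone. *)
Lemma weight_prod (al : vertex D) (J : {set {set point D}}) :
    J \subset circles al ->
  qvar ^ (gr_j (al, cover J) - gr_k (al, cover J)) =
  qvar ^ (#|al|%:Z + n_plus D - 2 * n_minus D) *
  \prod_(C in circles al) weight al C (C \in J).
Proof.
move=> hJ; pose g : generator D := (al, cover J).
pose S n b := [set C in circles al | (nontrivial al C == n) && ((C \in J) == b)].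
have E1 : [set C in circles al | plus g C] = S true true :|: S false true.
  apply/setP=> C; rewrite !inE; case hC: (C \in circles al) => //=.
  by rewrite cover_plus //; case: (C \in J); case: (nontrivial al C).
have E2 : [set C in circles al | ~~ plus g C] = S true false :|: S false false.
  apply/setP=> C; rewrite !inE; case hC: (C \in circles al) => //=.
  by rewrite cover_plus //; case: (C \in J); case: (nontrivial al C).
have E3 : [set C in circles al | nontrivial al C && plus g C] = S true true.
  apply/setP=> C; rewrite !inE; case hC: (C \in circles al) => //=.
  by rewrite cover_plus //; case: (C \in J); case: (nontrivial al C).
have E4 : [set C in circles al | nontrivial al C && ~~ plus g C] = S true false.
  apply/setP=> C; rewrite !inE; case hC: (C \in circles al) => //=.
  by rewrite cover_plus //; case: (C \in J); case: (nontrivial al C).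
have disj b : #|S true b :|: S false b| = (#|S true b| + #|S false b|)%N.
  apply/eqP; have [_ ->] := leq_card_setU (S true b) (S false b).
  rewrite disjoints_subset; apply/subsetP=> C.
  by rewrite !inE; case: (nontrivial al C); rewrite ?andbF.
rewrite /gr_j /gr_k /= -/g E1 E2 E3 E4 !disj !PoszD.
have -> : forall a b c d e f h : int, a + b - (c + d) + e + f - h - (a - c) =
   (e + f - h) + (b - d) by move=> *; ring.
rewrite expfzDr ?qvar_neq0 //; congr (_ * _).
rewrite (bigID (fun C => nontrivial al C)) /= big1 ?mul1r; last first.
  by move=> C /andP[_ h]; rewrite /weight h.
rewrite (bigID (fun C => C \in J)) /=.
rewrite expfzDr ?qvar_neq0 // -exprz_inv; congr (_ * _).
  rewrite (eq_bigr (fun=> qvar)).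
    rewrite prodr_const -exprnP; congr (_ ^+ _); apply: eq_card => C.
    rewrite [RHS]unfold_in !inE.
    by case: (C \in circles al); case: (nontrivial al C); case: (C \in J).
  by move=> C /andP[/andP[_ h1] h2]; rewrite /weight (negbTE h1) h2.
rewrite (eq_bigr (fun=> qvar^-1)).
  rewrite prodr_const -exprnP; congr (_ ^+ _); apply: eq_card => C.
  rewrite [RHS]unfold_in !inE.
    by case: (C \in circles al); case: (nontrivial al C); case: (C \in J).
by move=> C /andP[/andP[_ h1] h2]; rewrite /weight (negbTE h1) (negbTE h2).
Qed.

(** Distributivity over all sets J; extending the factors by 0 and 1 outside [circles al] kills
    every J that is not contained in it. *)
Lemma sum_weights (al : vertex D) :
  \sum_(J : {set {set point D}} | J \subset circles al)
     \prod_(C in circles al) weight al C (C \in J) =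
  \prod_(C in circles al) (weight al C true + weight al C false).
Proof.
pose F C := if C \in circles al then weight al C true else 0.
pose G C := if C \in circles al then weight al C false else 1.
transitivity (\prod_C (F C + G C)); last first.
  rewrite [RHS]big_mkcond; apply: eq_bigr => C _; rewrite /F /G.
  by case: ifP; rewrite ?add0r.
rewrite bigA_distr /= big_mkcond; apply: eq_bigr => J _; case: ifP => hJ.
  rewrite big_mkcond; apply: eq_bigr => C _; rewrite /F /G.
  by case: ifP; case: ifP => // h1 h2; rewrite (subsetP hJ) in h2.
case/negbT/subsetPn: hJ => C hC hC'.
by rewrite (bigD1 C) //= hC /F (negbTE hC') mul0r.
Qed.

Lemma is_laurent_weights (al : vertex D) (A : pred {set point D}) :
  is_laurent (\prod_(C | A C) (weight al C true + weight al C false)).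
Proof.
elim/big_rec: _ => [|C x _]; first exact: (is_laurent_int 1).
apply: is_laurentM; rewrite /weight; case: ifP => _.
  exact: (is_laurentD (is_laurent_int 1) (is_laurent_int 1)).
exact: is_laurentD is_laurent_q is_laurent_qV.
Qed.

Lemma weights_eqmod2 (al : vertex D) :
  laurent_eqmod2 (\prod_(C in circles al) (weight al C true + weight al C false))
    (if trivial_state al then (qvar + qvar^-1) ^+ #|circles al| else 0).
Proof.
rewrite trivial_stateE; case: ifP => [/forall_inP h|/negbT].
  rewrite -prodr_const (eq_bigr (fun=> qvar + qvar^-1)); first exact: eqmod2_refl.
  by move=> C hC; rewrite /weight (negbTE (h C hC)).
rewrite negb_forall_in => /exists_inP[C hC]; rewrite negbK => hn.
rewrite (bigD1 C) //= /weight hn -/(weight al) -mulr2n -[2%:R]/(2%:R : Zq).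
by apply: eqmod2_0; apply: is_laurent_weights.
Qed.

Lemma normE (K : fieldType) (q : K) s w s' : run s w = Some s' ->
  norm q s w = \prod_(l < size w)
     cross_norm q (odflt [::] (run s (take l w))) (nth (Cap 0) w l).
Proof.
elim: w s => [|f w IHw] s; first by rewrite big_ord0.
rewrite run_cons; case E: (act f s) => [s1|] //= h.
rewrite big_ord_recl /= E /= (IHw s1) //; congr (_ * _).
by apply: eq_bigr => l _; rewrite /= run_cons E.
Qed.

Lemma norm_word : norm qvar (base D) (word D) =
  (-1) ^+ #|[set l in crossings D | ~~ positive D l]| * qvar ^ (n_plus D - 2 * n_minus D).
Proof.
rewrite (normE _ (run_word D)).
rewrite (bigID (fun l => l \in crossings D)) /= [X in _ * X]big1 ?mulr1; last first.
  by move=> l; rewrite inE /slice_at; case: (nth _ _ _).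
rewrite (bigID (fun l : 'I_m => positive D l)) /=.
rewrite (eq_bigr (fun=> qvar)); last first.
  move=> l /andP[_]; rewrite /positive /slice_at /signs.
  by case: (nth _ _ _) => //= i c ->.
rewrite [X in _ * X](eq_bigr (fun=> - qvar ^- 2)); last first.
  move=> l /andP[]; rewrite inE /positive /slice_at /signs.
  by case: (nth _ _ _) => //= i c _ /negbTE ->.
rewrite !prodr_const /n_plus /n_minus.
set a := #|_|; set b := #|_|.
have -> : #|[set l in crossings D | positive D l]| = a.
  by apply: eq_card => l; rewrite [RHS]unfold_in inE.
have -> : #|[set l in crossings D | ~~ positive D l]| = b.
  by apply: eq_card => l; rewrite [RHS]unfold_in inE.
rewrite expfzDr ?qvar_neq0 // -invr_expz -PoszM -!exprnP exprM [in LHS]exprNn exprVn.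
by rewrite mulrCA.
Qed.

Lemma eqmod2_sign k f : is_laurent f -> laurent_eqmod2 ((-1) ^+ k * f) f.
Proof.
move=> hf; rewrite -signr_odd; case: (odd k); last by rewrite mul1r; apply: eqmod2_refl.
by rewrite expr1 mulN1r; apply: eqmod2N.
Qed.

Lemma AKh_poly_eqmod2 :
  laurent_eqmod2 (AKh_poly D 1 qvar qvar^-1) (state_sum qvar D).
Proof.
apply: eqmod2_trans (AKh_poly_gens D) _.
pose compat (al : vertex D) (P : {set point D}) :=
  [forall C in circles al, (C \subset P) || [disjoint C & P]].
have -> : \sum_(g in generators D) qvar ^ (gr_j g - gr_k g) =
    \sum_(al : vertex D | al \subset crossings D) \sum_(P | compat al P)
      qvar ^ (gr_j (al, P) - gr_k (al, P)).
  rewrite pair_big_dep /=; apply: eq_big => [[al P]|[al P] _] //.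
  by rewrite inE.
rewrite /state_sum mulr_sumr; apply: eqmod2_sum => al _.
rewrite sum_labelings (eq_bigr _ (fun J hJ => weight_prod hJ)) -mulr_sumr sum_weights.
rewrite norm_word [(- qvar) ^+ _]exprNn [X in laurent_eqmod2 _ X]mulrA mulrACA -exprD -mulrA.
(* k collects the signs of [norm] and of the power of -q; [eqmod2_sign] discards them. *)
set k := (_ + _)%N; set Z := (if _ then _ else _).
have hZ : is_laurent Z.
  rewrite /Z; case: ifP => _; last exact: (is_laurent_int 0).
  exact/is_laurentX/is_laurentD/is_laurent_qV/is_laurent_q.
have -> : qvar ^ (n_plus D - 2 * n_minus D) * qvar ^+ #|al| =
    qvar ^ (#|al|%:Z + n_plus D - 2 * n_minus D).
  by rewrite exprnP -expfzDr ?qvar_neq0 // addrC addrA.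
apply: (eqmod2_trans (eqmod2Ml (is_laurent_exp _) (weights_eqmod2 al))).
apply/eqmod2_sym/eqmod2_sign/is_laurentM => //; exact: is_laurent_exp.
Qed.

End GeneratorSum.

Lemma eqmod2_sqr f g : is_laurent f -> is_laurent g -> laurent_eqmod2 f g ->
  laurent_eqmod2 (f ^+ 2) (g ^+ 2).
Proof.
move=> hf hg h; rewrite !expr2; apply: (eqmod2_trans (eqmod2Ml hf h)).
by rewrite [f * g]mulrC; apply: eqmod2Ml.
Qed.

Lemma is_laurent_AKh_poly D : is_laurent (AKh_poly D 1 qvar qvar^-1).
Proof.
apply: is_laurent_sum => -[[i j] k]; rewrite exp1rz mul1r exprz_inv.
apply: is_laurentM (is_laurent_int _).
exact: is_laurentM (is_laurent_exp _) (is_laurent_exp _).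
Qed.

Theorem corollary3 (Lt L : diagram) (hL : periodic_with_quotient Lt L) :
  laurent_eqmod2 (AKh_poly Lt 1 qvar qvar^-1) (AKh_poly L 1 qvar qvar^-1 ^+ 2).
Proof.
have [D [hLD hLt]] := hL.
apply: eqmod2_trans (AKh_poly_eqmod2 Lt) _.
rewrite (state_sum_isotopic hLt qvar_neq0).
apply: eqmod2_trans (state_sum_lift D) _.
rewrite -(state_sum_isotopic hLD qvar_neq0).
apply: eqmod2_sqr; [exact: is_laurent_state_sum|exact: is_laurent_AKh_poly|].
exact/eqmod2_sym/AKh_poly_eqmod2.
Qed.
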